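(* Let $([0,1],\mathcal{B}([0,1]),\nu,S)$ be a measure-preserving system with decay of correlation for functions of bounded variation against $L^1(\nu)$ with rate $\rho\colon\mathbb{N}\to\mathbb{R}_+$. Let $(I_n)_{n\in\mathbb{N}}$ be a sequence of intervals $I_n\subseteq[0,1]$ such that $\nu(I_n)=n^{-a}$ for some $a\in(0,1/14)$, let $\varphi\colon\mathbb{N}\to\mathbb{N}$ be an increasing function, and suppose that there exists $C>0$ such that for all $n\in\mathbb{N}$ $$\rho\big(\varphi(n+1)-\varphi(n)\big)\le \frac{C}{n}.$$ Consider the sequence $(a_n(y))_{n\in\mathbb{N}}$ given by $$\{n\in\mathbb{N}:\ S^{\varphi(n)}y\in I_n\}=\{a_1(y)<a_2(y)<\cdots\},$$ which is well defined for $\nu$-almost every $y\in[0,1]$. Then, for $\nu$-almost every $y\in[0,1]$, the following holds: for every probability space $(X,\mathcal{X},\mu)$, every pair of commuting measure-preserving transformations $T_1,T_2\colon X\to X$, and every $f_1,f_2\in L^\infty(\mu)$, $$\lim_{N\to\infty}\frac1N\sum_{n=1}^N f_1(T_1^n x)\,f_2(T_2^{a_n(y)}x)=\mathbb{E}(f_1|\mathcal{I}(T_1))(x)\,\mathbb{E}(f_2|\mathcal{I}(T_2))(x)$$ for $\mu$-almost every $x\in X$.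
   Context: A measure preserving system is a tuple $(X,\mathcal{X},\mu,T)$ with $(X,\mathcal{X},\mu)$ a probability space and $T\colon X\to X$ measurable with $\mu(T^{-1}A)=\mu(A)$ for all $A\in\mathcal{X}$. $\mathcal{I}(T)=\{A\in\mathcal{X}:\mu(A\,\Delta\, T^{-1}A)=0\}$, and $\mathbb{E}(f|\mathcal{I}(T))$ is the conditional expectation. For $f\colon[0,1]\to\mathbb{R}$, $\|f\|_{BV}:=\|f\|_\infty+\sup\sum_{i=0}^{m-1}|f(x_{i+1})-f(x_i)|$, the supremum being over all finite sequences $0=x_0<x_1<\cdots<x_m=1$; $f$ has bounded variation if $\|f\|_{BV}<\infty$. The system $([0,1],\mathcal{B}([0,1]),\nu,S)$ has decay of correlation for functions of bounded variation against $L^1(\nu)$ with rate $\rho\colon\mathbb{N}\to\mathbb{R}_+$ if there exists $C'>0$ such that $$\left|\int_{[0,1]} f\cdot g\circ S^m\,d\nu-\int_{[0,1]} f\,d\nu\int_{[0,1]} g\,d\nu\right|\le C'\rho(m)\|f\|_{BV}\|g\|_{L^1(\nu)}$$ for every $m\in\mathbb{N}$, every $f$ of bounded variation and every $g\in L^1(\nu)$. *)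

(* Defs.v *)
From HB Require Import structures.
From mathcomp Require Import all_boot all_order all_algebra.
From mathcomp Require Import all_classical all_reals all_analysis.
From mathcomp Require Import measurable_realfun ess_sup_inf.

Set Implicit Arguments.
Unset Strict Implicit.
Unset Printing Implicit Defensive.
Import Order.TTheory GRing.Theory Num.Theory.
Import numFieldNormedType.Exports.

Local Open Scope classical_set_scope.
Local Open Scope ring_scope.

(* Throughout, the positive integers are the [n : nat] with [0 < n]; the value
   at 0 of a sequence indexed by the positive integers is never used. *)

Section unit_interval.
Variable R : realType.

Definition unitI : Type := {x : R | x \in `[0, 1]}.

HB.instance Definition _ := SubType.on unitI.
HB.instance Definition _ := Choice.on unitI.

Lemma zero_in_unitI : (0 : R) \in `[0, 1].
Proof. by rewrite in_itv/= lexx ler01. Qed.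

Definition unitI0 : unitI := exist _ 0 zero_in_unitI.

HB.instance Definition _ := isPointed.Build unitI unitI0.

Definition unitI_val (t : unitI) : R := val t.

(* The trace on [0, 1] of the Borel sigma-algebra of R. *)
HB.instance Definition _ :=
  Measurable.copy unitI (g_sigma_algebra_preimageType unitI_val).

End unit_interval.

Section bounded_variation_norm.
Local Open Scope ereal_scope.
Variable R : realType.

(* [insubd (unitI0 R)] is the identity on [0, 1], and the partitions
   0 = x_0 < ... < x_m = 1 only involve points of [0, 1], so the second term is
   the total variation of [f] itself, whatever the extension outside [0, 1]. *)
Definition BVnorm (f : unitI R -> R) : \bar R :=
  ereal_sup [set `|f t|%:E | t in [set: unitI R]]
  + total_variation 0 1 (fun x : R => f (insubd (unitI0 R) x)).

End bounded_variation_norm.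

Section measure_preserving.
Context d (X : measurableType d) (R : realType).

Definition measure_preserving (mu : probability X R) (T : X -> X) : Prop :=
  measurable_fun [set: X] T /\
  forall A, measurable A -> mu (T @^-1` A) = mu A.

Definition invariant_sets (mu : probability X R) (T : X -> X) : set (set X) :=
  [set A | measurable A /\ mu (A `+` T @^-1` A) = 0%E].

(* [h] is a version of the conditional expectation of [f] given the
   sigma-algebra [G]. *)
Definition is_cond_exp (mu : probability X R) (G : set (set X))
    (f h : X -> R) : Prop :=
  [/\ forall B : set R, measurable B -> G (h @^-1` B),
      mu.-integrable [set: X] (EFin \o h) &
      forall A, G A -> \int[mu]_(x in A) h x = \int[mu]_(x in A) f x].

(* A chosen version; one exists for integrable [f], see [cond_expP] and
   [sigma_algebra_invariant_sets]. *)
Definition cond_exp (mu : probability X R) (G : set (set X)) (f : X -> R) :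
    X -> R :=
  get [set h | is_cond_exp mu G f h].

End measure_preserving.

Lemma factor_cond_exp d d' (X : measurableType d) (Y : measurableType d')
    (R : realType) (mu : probability X R) (phi : {mfun X >-> Y}) (f : X -> R) :
  mu.-integrable [set: X] (EFin \o f) ->
  exists h : Y -> R, [/\ measurable_fun [set: Y] h,
    mu.-integrable [set: X] (EFin \o (h \o phi)) &
    forall A, measurable A ->
      \int[mu]_(x in phi @^-1` A) h (phi x) = \int[mu]_(x in phi @^-1` A) f x].
Proof.
move=> intf.
have mphi : measurable_fun [set: X] phi by [].
have mpre A : measurable A -> measurable (phi @^-1` A).
  by move=> mA; rewrite -[X in measurable X]setTI; exact: mphi.
pose nu : {charge set Y -> \bar R} :=
  measure_function_pushforward__canonical__charge_Charge
    (induced_charge intf) mphi.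
have numu : nu `<< distribution mu phi.
  apply/null_content_dominatesP => A mA muA.
  apply: null_set_integral => //; first exact: mpre.
  apply: (measurable_funS measurableT) => //; exact: measurable_int intf.
pose h := Radon_Nikodym nu (distribution mu phi).
have hfin x : h x \is a fin_num by exact: Radon_Nikodym_fin_num.
have inth : (distribution mu phi).-integrable setT h
  by exact: Radon_Nikodym_integrable.
have mh := measurable_int _ inth.
have hE : EFin \o (fine \o h \o phi) = h \o phi.
  by apply/funext => x /=; rewrite fineK.
have inthX : mu.-integrable setT (h \o phi).
  apply/integrableP; split; first exact: measurableT_comp.
  move/integrableP : inth => [_]; apply: le_lt_trans.
  by rewrite ge0_integral_distribution//; exact: measurableT_comp.
exists (fine \o h); split.
- exact: measurableT_comp.
- by rewrite hE.
- move=> A mA; congr fine; transitivity (nu A); last by [].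
  rewrite (Radon_Nikodym_integral numu mA) integral_pushforward//.
    by apply: eq_integral => x _ /=; rewrite fineK.
  by apply: integrableS inthX => //; exact: mpre.
Qed.

Lemma cond_expP d (X : measurableType d) (R : realType) (mu : probability X R)
    (G : set (set X)) (f : X -> R) :
  sigma_algebra [set: X] G -> G `<=` measurable ->
  mu.-integrable [set: X] (EFin \o f) ->
  is_cond_exp mu G f (cond_exp mu G f).
Proof.
move=> sG Gm intf; apply: (@getPex _ [set h | is_cond_exp mu G f h]).
pose toG (x : X) : g_sigma_algebraType G := x.
have GE : G.-sigma.-measurable = G by exact: sigma_algebra_id.
have mtoG : measurable_fun [set: X] toG.
  by move=> _ B; rewrite GE setTI => /Gm.
pose toGm : {mfun X >-> g_sigma_algebraType G} :=
  HB.pack toG (isMeasurableFun.Build _ _ _ _ toG mtoG).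
have [h [mh inth hE]] := factor_cond_exp toGm intf.
exists h; split => //.
- by move=> B mB; rewrite -GE -[X in _ X]setTI; exact: mh.
- by move=> A GA; apply: (hE A); rewrite GE.
Qed.

Lemma sigma_algebra_invariant_sets d (X : measurableType d) (R : realType)
    (mu : probability X R) (T : X -> X) :
  measurable_fun [set: X] T -> sigma_algebra [set: X] (invariant_sets mu T).
Proof.
move=> mT.
have mpre A : measurable A -> measurable (T @^-1` A).
  by move=> mA; rewrite -[X in measurable X]setTI; exact: mT.
have mY A : measurable A -> measurable (A `+` T @^-1` A).
  by move=> mA; apply: measurableU; apply: measurableD => //; exact: mpre.
split.
- by split => //; rewrite preimage_set0 setYK measure0.
- move=> A [mA A0]; rewrite setTD; split; first exact: measurableC.
  rewrite -A0; congr (mu _); rewrite preimage_setC !setY_def !setDE !setCK.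
  by rewrite setUC; congr (_ `|` _); rewrite setIC.
- move=> F FI; split; first by apply: bigcup_measurable => n _; case: (FI n).
  apply: (@subset_measure0 _ _ _ mu _ (\bigcup_n (F n `+` T @^-1` F n))).
  + by apply: mY; apply: bigcup_measurable => n _; case: (FI n).
  + by apply: bigcup_measurable => n _; apply: mY; case: (FI n).
  + move=> x; rewrite setY_def preimage_bigcup => -[[[n _ Fx] nFx]|[[n _ Fx] nFx]];
      exists n => //; rewrite setY_def; [left|right]; split => //;
      by move=> Fx'; apply: nFx; exists n.
  + apply/measure_negligible; first by
      apply: bigcup_measurable => n _; apply: mY; case: (FI n).
    apply: negligible_bigcup => n; have [mF F0] := FI n.
    by exists (F n `+` T @^-1` F n); split => //; exact: mY.
Qed.

Section decay_of_correlation.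
Variable R : realType.

Definition decay_of_correlation (nu : probability (unitI R) R)
    (S : unitI R -> unitI R) (rho : nat -> R) : Prop :=
  exists2 C' : R, 0 < C' &
    forall (m : nat) (f g : unitI R -> R), (0 < m)%N ->
      (BVnorm f < +oo)%E -> g \in Lfun nu 1%E ->
      (`| \int[nu]_t (f t * g (iter m S t))
          - (\int[nu]_t f t) * (\int[nu]_t g t) |%:E
       <= (C' * rho m)%:E * BVnorm f * 'N[nu]_1%E[EFin \o g])%E.

End decay_of_correlation.

Definition increasing_seq1 (u : nat -> nat) : Prop :=
  forall m n : nat, (0 < m < n)%N -> (u m < u n)%N.

(* [A] is the infinite set { b 1 < b 2 < ... }. *)
Definition enumerates (A : set nat) (b : nat -> nat) : Prop :=
  increasing_seq1 b /\ b @` [set n | (0 < n)%N] = A.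

Definition hitting_times (R : realType) (S : unitI R -> unitI R)
    (phi : nat -> nat) (I : nat -> interval R) (y : unitI R) : set nat :=
  [set n | (0 < n)%N /\ unitI_val (iter (phi n) S y) \in I n].

(* Main.v *)
(* Write w_k for the indicator of S^phi(k) y in I_k, s_k = w_1 + ... + w_k,
   sigma_k = k^-a and W_N = sigma_1 + ... + sigma_N.  Decay of correlation makes
   w_k - sigma_k almost orthogonal to every bounded function of the later hits,
   with error O(1/k); second moments then give s_N ~ W_N almost surely.

   Summing over k = a_n(y) instead of n turns the averages into
     1/s_N sum_{k <= N} w_k f_1(T_1^{s_k} x) f_2(T_2^k x),
   and one splits w_k = (w_k - sigma_k) + sigma_k.

   For the centered part, two steps of van der Corput type (expanding squares
   over blocks of lengths M_1 and M_2, using that T_1 and T_2 commute and preserve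
   the measure) bound the L^2 norm, uniformly over all systems, by a quantity
   that only depends on w.  Its expectation is again a second moment.  With
   N = j^(14c+2), M_1 = j^c, M_2 = j^(4c), where (14c+2)a <= c-2, which is possible
   because a < 1/14, it is O(j^-2) after normalization, hence summable; the
   sequence j^(14c+2) is dense enough to interpolate.

   For the sigma-part, s_k rarely changes, so f_2 may be replaced by its averages
   over long windows; these tend to 0 by the pointwise ergodic theorem when
   E(f_2|I(T_2)) = 0.  When f_2 is T_2-invariant, the average reduces to the ergodic
   theorem for T_1. *)

Require Import Defs.
From HB Require Import structures.
From mathcomp Require Import all_boot all_order all_algebra.
From mathcomp Require Import all_classical all_reals all_analysis.
From mathcomp Require Import measurable_realfun ess_sup_inf.
From mathcomp Require Import zify ring lra.
Import Order.TTheory GRing.Theory Num.Theory.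
Import numFieldNormedType.Exports.
Local Open Scope classical_set_scope.
Local Open Scope ring_scope.
Set Implicit Arguments.
Unset Strict Implicit.

(** * Finite sums *)

(** The null set of y must be fixed before any system is given, so y is selected by two properties
    of its hits alone; the rest holds for each such y.

    The number 14 comes from balancing costs, up to small powers of j. The diagonal of the first
    step costs N W_N / M_1, so W_N must exceed N / M_1. Because the second step has a diagonal too,
    the off-diagonal terms of the first cost at least N^2 / M_2^(1/2), which matches (N / M_1)^2
    when M_2 = M_1^4. After the second step one unknown integral is left for each of the M_1 M_2 M_1
    possible shifts of the exponents of T_1; removing them costs M_2 (M_1^2 M_2 N)^(1/2), which may
    not exceed N, and this gives N = M_2^3 M_1^2 = M_1^14. So W_N, of order N^(1-a), must exceed
    N^(13/14). Strictness of a < 1/14 leaves room for a few more powers of j, which pay for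
    summability and for a crude bound on harmonic sums. *)

Lemma sum_sqr (R : comNzRingType) (g : nat -> R) (N : nat) :
  (\sum_(0 <= k < N) g k) ^+ 2 =
  \sum_(0 <= k < N) g k ^+ 2 +
  2 * \sum_(0 <= k < N) \sum_(k.+1 <= l < N) g k * g l.
Proof.
elim: N => [|N IH]; first by rewrite !big_nil; ring.
rewrite !(big_nat_recr N 0)//= sqrrD IH.
have -> : \sum_(N.+1 <= l < N.+1) g N * g l = 0 by rewrite big_geq.
have -> : \sum_(0 <= k < N) \sum_(k.+1 <= l < N.+1) g k * g l =
    \sum_(0 <= k < N) \sum_(k.+1 <= l < N) g k * g l +
    (\sum_(0 <= k < N) g k) * g N.
  rewrite mulr_suml -big_split/=; apply: eq_big_nat => k /andP[_ kN].
  by rewrite big_nat_recr.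
ring.
Qed.

(** The pairs are listed by their lag h. The indicator makes the range of k independent of h, so
    that several blocks can be added lag by lag. *)
Lemma sum_sqr_lag (R : comNzRingType) (g : nat -> R) (M : nat) :
  (\sum_(0 <= k < M) g k) ^+ 2 =
  \sum_(0 <= k < M) g k ^+ 2 +
  2 * \sum_(1 <= h < M) \sum_(0 <= k < M) (k + h < M)%N%:R * (g k * g (k + h)%N).
Proof.
rewrite sum_sqr; congr (_ + 2 * _).
rewrite exchange_big_nat/=; apply: eq_big_nat => k /andP[_ kM].
rewrite -{1}[k.+1]add1n big_addn.
rewrite (big_cat_nat (n := (M - k)%N) _ _ (p := M))/=; [|lia|lia].
rewrite [X in _ + X]big_nat_cond [X in _ + X]big1 ?addr0; last first.
  move=> h /andP[/andP[h1 h2] _].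
  by rewrite (_ : (k + h < M)%N = false) ?mul0r//; lia.
apply: eq_big_nat => h /andP[h1 h2].
by rewrite (_ : (k + h < M)%N = true) ?mul1r 1?addnC//; lia.
Qed.

Lemma sum_nat_blocks (V : nmodType) (F : nat -> V) (M B : nat) :
  \sum_(0 <= k < M * B) F k =
  \sum_(0 <= b < B) \sum_(0 <= r < M) F (b * M + r)%N.
Proof.
elim: B => [|B IH]; first by rewrite muln0 !big_nil.
rewrite big_nat_recr//= -IH mulnS addnC.
rewrite (big_cat_nat (n := (M * B)%N))//=; last by lia.
congr (_ + _); rewrite -{1}[(M * B)%N]add0n big_addn addKn.
by apply: eq_big_nat => r _; rewrite addnC mulnC.
Qed.

Lemma sqr_sum_le (R : realDomainType) (G : nat -> R) (B : nat) :
  (\sum_(0 <= b < B) G b) ^+ 2 <= B%:R * \sum_(0 <= b < B) G b ^+ 2.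
Proof.
case: B => [|B]; first by rewrite !big_nil expr0n mul0r.
set s := \sum_(0 <= b < B.+1) G b.
have B0 : 0 < B.+1%:R :> R by [].
have : 0 <= \sum_(0 <= b < B.+1) (B.+1%:R * G b - s) ^+ 2.
  by apply: sumr_ge0 => b _; exact: sqr_ge0.
have -> : \sum_(0 <= b < B.+1) (B.+1%:R * G b - s) ^+ 2 =
    B.+1%:R * (B.+1%:R * (\sum_(0 <= b < B.+1) G b ^+ 2) - s ^+ 2).
  under eq_bigr => b _.
    rewrite (_ : _ ^+ 2 = B.+1%:R ^+ 2 * G b ^+ 2 - (2 * B.+1%:R * s) * G b + s ^+ 2);
      last by ring.
    over.
  rewrite big_split/= sumrB -!mulr_sumr big_const_nat subn0 iter_addr_0 -/s.
  by rewrite -[_ *+ _]mulr_natl; ring.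
by rewrite pmulr_rge0// subr_ge0.
Qed.

(** Van der Corput's inequality on disjoint blocks: Cauchy-Schwarz over the [B] blocks, then
    [sum_sqr_lag] inside each. Only pairs within one block are correlated, hence the condition on
    [k %% M]; no index beyond the last block gets a nonzero coefficient. *)
Lemma block_sqr_sum_le (R : realDomainType) (g : nat -> R) (M B : nat) :
  (\sum_(0 <= k < M * B) g k) ^+ 2 <=
  B%:R * (\sum_(0 <= k < M * B) g k ^+ 2 +
    2 * \sum_(1 <= h < M) \sum_(0 <= k < M * B)
      (k %% M + h < M)%N%:R * (g k * g (k + h)%N)).
Proof.
rewrite [X in X ^+ 2]sum_nat_blocks.
apply: (le_trans (sqr_sum_le (fun b => \sum_(0 <= r < M) g (b * M + r)%N) B)).
apply: ler_wpM2l; first exact: ler0n.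
rewrite [X in _ <= X + _]sum_nat_blocks.
under [X in _ <= _ + 2 * X]eq_bigr do rewrite sum_nat_blocks.
rewrite [X in _ + 2 * X]exchange_big_nat/= [X in _ + X]mulr_sumr -big_split/=.
apply: ler_sum => b _; rewrite sum_sqr_lag lerD2l ler_wpM2l//.
rewrite le_eqVlt; apply/orP; left; apply/eqP.
apply: eq_bigr => h _; apply: eq_big_nat => r /andP[_ rM].
by rewrite modnMDl modn_small// addnA.
Qed.

(** Between consecutive powers of j there are fewer than [j ^ p.+1] terms of size at most 1 / j^p,
    hence a contribution of at most j. A logarithm would be the true size; the exponents chosen
    later can afford one factor j. *)
Lemma harmonic_sum_le (R : realFieldType) (j p : nat) : (0 < j)%N ->
  \sum_(0 <= k < j ^ p) k.+1%:R^-1 <= 1 + p%:R * j%:R :> R.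
Proof.
move=> j0; elim: p => [|p IH].
  by rewrite expn0 big_nat1 invr1 mul0r addr0.
have jp : (j ^ p <= j ^ p.+1)%N by rewrite leq_pexp2l.
rewrite (big_cat_nat (n := (j ^ p)%N))//=.
have h : \sum_(j ^ p <= k < j ^ p.+1) k.+1%:R^-1 <= j%:R :> R.
  have jp0 : 0 < (j ^ p)%:R :> R by rewrite ltr0n expn_gt0 j0.
  apply: (@le_trans _ _ (\sum_(j ^ p <= k < j ^ p.+1) (j ^ p)%:R^-1)).
    rewrite big_nat_cond [leRHS]big_nat_cond.
    apply: ler_sum => k /andP[/andP[k1 k2] _].
    by rewrite lef_pV2 ?posrE// ler_nat; lia.
  rewrite sumr_const_nat -[_ *+ _]mulr_natr mulrC ler_pdivrMr// -natrM ler_nat.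
  by rewrite expnS; lia.
rewrite -natr1 mulrDl mul1r addrA; exact: lerD.
Qed.

(** Expand (y - l x)^2 >= 0. This removes a factor x of which only a bound is known. The constant
    [l] is fixed in advance, unlike in Cauchy-Schwarz, so the result stays linear in y^2 and
    expectations can be taken later. *)
Lemma young_mul (R : realFieldType) (l x y : R) : 0 < l -> `|x| <= 1 ->
  2 * (x * y) <= l + y ^+ 2 / l.
Proof.
move=> l0 x1.
have h : 0 <= (y - l * x) ^+ 2 by exact: sqr_ge0.
have x2 : x ^+ 2 <= 1 by rewrite -real_normK ?num_real// expr_le1.
rewrite -(ler_pM2r l0) [leRHS]mulrDl divfK ?gt_eqF//; nra.
Qed.

(** * Bounded measurable functions *)

Section bounded_measurable.
Context d (X : measurableType d) (R : realType) (mu : probability X R).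
Implicit Types (f g : X -> R) (T : X -> X).

(** Bounded everywhere, not only almost everywhere: the class is stable under the algebraic
    operations and composition, and its members are integrable for every probability. *)
Definition bounded_measurable f : Prop :=
  measurable_fun [set: X] f /\ exists M : R, forall x, `|f x| <= M.

Lemma bounded_measurable_cst c : bounded_measurable (fun=> c).
Proof. by split; [exact: measurable_cst | exists `|c|]. Qed.

Lemma bounded_measurableD f g : bounded_measurable f -> bounded_measurable g ->
  bounded_measurable (fun x => f x + g x).
Proof.
move=> [mf [M fM]] [mg [M' gM']]; split; first exact: measurable_funD.
by exists (M + M') => x; rewrite (le_trans (ler_normD _ _))// lerD.
Qed.

Lemma bounded_measurableM f g : bounded_measurable f -> bounded_measurable g ->
  bounded_measurable (fun x => f x * g x).
Proof.
move=> [mf [M fM]] [mg [M' gM']]; split; first exact: measurable_funM.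
by exists (M * M') => x; rewrite normrM ler_pM.
Qed.

Lemma bounded_measurableZ c f : bounded_measurable f ->
  bounded_measurable (fun x => c * f x).
Proof. by move=> bf; apply: bounded_measurableM => //; exact: bounded_measurable_cst. Qed.

Lemma bounded_measurableN f : bounded_measurable f ->
  bounded_measurable (fun x => - f x).
Proof.
move=> [mf [M fM]]; split; first exact: measurableT_comp.
by exists M => x; rewrite normrN.
Qed.

Lemma bounded_measurableB f g : bounded_measurable f -> bounded_measurable g ->
  bounded_measurable (fun x => f x - g x).
Proof.
by move=> bf bg; apply: bounded_measurableD => //; exact: bounded_measurableN.
Qed.

Lemma bounded_measurableX f n : bounded_measurable f ->
  bounded_measurable (fun x => f x ^+ n).
Proof.
move=> [mf [M fM]]; split; first exact: measurable_funX.
by exists (M ^+ n) => x; rewrite normrX lerXn2r// ?nnegrE// (le_trans _ (fM x)).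
Qed.

Lemma bounded_measurable_norm f : bounded_measurable f ->
  bounded_measurable (fun x => `|f x|).
Proof.
move=> [mf [M fM]]; split; first exact: measurableT_comp.
by exists M => x; rewrite normr_id.
Qed.

Lemma bounded_measurable_sum (I : Type) (r : seq I) (P : pred I) (F : I -> X -> R) :
  (forall i, P i -> bounded_measurable (F i)) ->
  bounded_measurable (fun x => \sum_(i <- r | P i) F i x).
Proof.
move=> bF; elim: r => [|i r IH].
  rewrite (_ : (fun x => _) = fun=> 0); first exact: bounded_measurable_cst.
  by apply/funext => x; rewrite big_nil.
rewrite (_ : (fun x => _) = fun x => (if P i then F i else fun=> 0) x +
    \sum_(i <- r | P i) F i x); last first.
  by apply/funext => x; rewrite big_cons; case: ifP => //; rewrite add0r.
apply: bounded_measurableD => //; case: ifPn => [Pi|_]; first exact: bF.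
exact: bounded_measurable_cst.
Qed.

Lemma bounded_measurable_comp T f : measurable_fun [set: X] T ->
  bounded_measurable f -> bounded_measurable (fun x => f (T x)).
Proof.
by move=> mT [mf [M fM]]; split; [exact: measurableT_comp | exists M => x].
Qed.

Lemma bounded_measurable_integrable f : bounded_measurable f ->
  mu.-integrable [set: X] (EFin \o f).
Proof.
move=> [mf [M fM]]; apply: measurable_bounded_integrable => //.
  exact: le_lt_trans (probability_le1 mu measurableT) (ltry _).
exists M; split; first exact: num_real.
by move=> y My x _ /=; rewrite (le_trans (fM x))// ltW.
Qed.

Lemma Rintegral_sum (I : Type) (r : seq I) (P : pred I) (F : I -> X -> R) :
  (forall i, P i -> bounded_measurable (F i)) ->
  \int[mu]_x (\sum_(i <- r | P i) F i x) = \sum_(i <- r | P i) \int[mu]_x F i x.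
Proof.
move=> bF; elim: r => [|i r IH].
  rewrite big_nil; under eq_Rintegral do rewrite big_nil.
  by rewrite Rintegral_cst// mul0r.
rewrite big_cons; under eq_Rintegral do rewrite big_cons.
case: ifPn => // Pi; rewrite RintegralD ?IH//; apply: bounded_measurable_integrable.
- exact: bF.
- exact: bounded_measurable_sum.
Qed.

Lemma ler_Rintegral f g : bounded_measurable f -> bounded_measurable g ->
  (forall x, f x <= g x) -> \int[mu]_x f x <= \int[mu]_x g x.
Proof.
by move=> bf bg fg; apply: le_Rintegral => //; exact: bounded_measurable_integrable.
Qed.

Lemma Rintegral_prob_cst c : \int[mu]_x c = c.
Proof.
rewrite Rintegral_cst// (_ : fine _ = 1) ?mulr1//.
exact: (congr1 fine (probability_setT mu)).
Qed.

Lemma Rintegral_norm_le f c : bounded_measurable f ->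
  (forall x, `|f x| <= c) -> `|\int[mu]_x f x| <= c.
Proof.
move=> bf fc; apply: le_trans (le_normr_Rintegral _ _) _ => //.
  exact: bounded_measurable_integrable.
apply: le_trans (ler_Rintegral (bounded_measurable_norm bf) (bounded_measurable_cst c) fc) _.
by rewrite Rintegral_prob_cst.
Qed.

Lemma RintegralZ_bounded c f : bounded_measurable f ->
  \int[mu]_x (c * f x) = c * \int[mu]_x f x.
Proof. by move=> bf; rewrite RintegralZl//; exact: bounded_measurable_integrable. Qed.

Lemma RintegralD_bounded f g : bounded_measurable f -> bounded_measurable g ->
  \int[mu]_x (f x + g x) = \int[mu]_x f x + \int[mu]_x g x.
Proof.
by move=> bf bg; rewrite RintegralD//; exact: bounded_measurable_integrable.
Qed.

Lemma RintegralB_bounded f g : bounded_measurable f -> bounded_measurable g ->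
  \int[mu]_x (f x - g x) = \int[mu]_x f x - \int[mu]_x g x.
Proof.
by move=> bf bg; rewrite RintegralB//; exact: bounded_measurable_integrable.
Qed.

Lemma measure_preserving_comp T T' : measure_preserving mu T ->
  measure_preserving mu T' -> measure_preserving mu (T \o T').
Proof.
move=> [mT pT] [mT' pT']; split; first exact: measurableT_comp.
by move=> A mA; rewrite comp_preimage pT' ?pT// -[X in measurable X]setTI; exact: mT.
Qed.

Lemma measure_preserving_iter T n : measure_preserving mu T ->
  measure_preserving mu (iter n T).
Proof.
move=> pT; elim: n => [|n IH]; last exact: measure_preserving_comp.
by split => //; exact: measurable_id.
Qed.

Lemma ge0_integral_comp T (f : X -> \bar R) : measure_preserving mu T ->
  measurable_fun [set: X] f -> (forall x, 0 <= f x)%E ->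
  (\int[mu]_x f (T x) = \int[mu]_x f x)%E.
Proof.
move=> [mT pT] mf f0.
pose T' : {mfun X >-> X} := HB.pack T (isMeasurableFun.Build _ _ _ _ T mT).
transitivity (\int[distribution mu T']_x f x)%E.
  by rewrite ge0_integral_distribution.
by apply: eq_measure_integral => A mA _; exact: pT.
Qed.

Lemma Rintegral_comp T f : measure_preserving mu T ->
  mu.-integrable [set: X] (EFin \o f) ->
  \int[mu]_x f (T x) = \int[mu]_x f x.
Proof.
move=> pT intf; have mf := measurable_int _ intf.
rewrite /Rintegral; congr fine; rewrite integralE [RHS]integralE; congr (_ - _)%E.
- rewrite -[RHS](ge0_integral_comp pT)//; last exact: measurable_funepos.
  by rewrite (funepos_comp (fun y => (f y)%:E) T).
- rewrite -[RHS](ge0_integral_comp pT)//; last exact: measurable_funeneg.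
  by rewrite (funeneg_comp (fun y => (f y)%:E) T).
Qed.

Lemma integrable_comp T f : measure_preserving mu T ->
  mu.-integrable [set: X] (EFin \o f) ->
  mu.-integrable [set: X] (EFin \o (fun x => f (T x))).
Proof.
move=> pT /integrableP[mf foo]; have [mT _] := pT; apply/integrableP; split.
  exact: (measurableT_comp mf).
by rewrite (ge0_integral_comp pT (f := fun x => `|(f x)%:E|%E))//; exact: measurableT_comp.
Qed.

Lemma ae_and (P Q : X -> Prop) : (\forall x \ae mu, P x) ->
  (\forall x \ae mu, Q x) -> \forall x \ae mu, P x /\ Q x.
Proof. by move=> aP aQ; apply: filterS2 aP aQ. Qed.

Lemma ae_comp T (P : X -> Prop) : measure_preserving mu T ->
  (\forall x \ae mu, P x) -> \forall x \ae mu, P (T x).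
Proof.
move=> [mT pT] [A [mA A0 PA]]; exists (T @^-1` A); split.
- by rewrite -[X in measurable X]setTI; exact: mT.
- by rewrite pT.
- by move=> x; exact: PA.
Qed.

Lemma ae_iter T (P : X -> Prop) : measure_preserving mu T ->
  (\forall x \ae mu, P x) -> \forall x \ae mu, forall n, P (iter n T x).
Proof.
by move=> pT aP; apply: ae_foralln => n; apply: ae_comp => //; exact: measure_preserving_iter.
Qed.

(** Beppo Levi: the sum of the series has finite integral, hence is finite almost everywhere. It
    turns summable bounds on integrals into pointwise ones, both for y and for x. *)
Lemma ae_bounded_series (F : nat -> X -> R) (C : R) :
  (forall j, bounded_measurable (F j)) -> (forall j x, 0 <= F j x) ->
  (forall J, \int[mu]_x (\sum_(0 <= j < J) F j x) <= C) ->
  \forall x \ae mu, exists C', forall J, \sum_(0 <= j < J) F j x <= C'.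
Proof.
move=> bF F0 FC.
pose G x : \bar R := (\sum_(j <oo) (F j x)%:E)%E.
have mF j : measurable_fun [set: X] (EFin \o F j).
  by apply/measurable_EFinP; case: (bF j).
have intG : mu.-integrable [set: X] G.
  apply/integrableP; split.
    apply: (@ge0_emeasurable_sum _ _ _ setT (fun j x => (F j x)%:E) xpredT) => //.
      by move=> j x _ _; rewrite lee_fin.
    by move=> j _; exact: mF.
  apply: (@le_lt_trans _ _ C%:E); last exact: ltry.
  have -> : (\int[mu]_x `|G x| = \int[mu]_x G x)%E.
    apply: eq_integral => x _; rewrite gee0_abs//.
    by apply: nneseries_ge0 => j _ _; rewrite lee_fin.
  rewrite integral_nneseries//; last by move=> j x _; rewrite lee_fin.
  apply: lime_le.
    apply: is_cvg_nneseries => j _ _; apply: integral_ge0 => x _.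
    by rewrite lee_fin.
  apply: nearW => J; rewrite -ge0_integral_sum//; last first.
    by move=> j x _; rewrite lee_fin.
  under eq_integral do rewrite sumEFin.
  rewrite -[leLHS]fineK ?lee_fin; first exact: FC.
  apply: integrable_fin_num => //.
  exact: (bounded_measurable_integrable (bounded_measurable_sum _ (fun j _ => bF j))).
move: (integrable_ae measurableT intG); apply: filterS => x /(_ I) Gx.
exists (fine (G x)) => J; rewrite -lee_fin fineK// -sumEFin.
by apply: nneseries_lim_ge => j _ _; rewrite lee_fin.
Qed.

Lemma Rintegral_dominated_cvg (F : nat -> X -> R) f g :
  (forall n, measurable_fun [set: X] (F n)) -> measurable_fun [set: X] f ->
  (\forall x \ae mu, F n x @[n --> \oo] --> f x) ->
  mu.-integrable [set: X] (EFin \o g) -> (forall n x, `|F n x| <= g x) ->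
  \int[mu]_x F n x @[n --> \oo] --> \int[mu]_x f x.
Proof.
move=> mF mf Ff intg Fg.
have [||||intf _ lim] := @dominated_convergence _ _ _ mu setT measurableT
    (fun n x => (F n x)%:E) (EFin \o f) (EFin \o g) _ _ _ intg.
- by move=> n; exact/measurable_EFinP.
- exact/measurable_EFinP.
- apply: filterS Ff => x Ff _; apply/cvg_EFin => //; exact: nearW.
- by apply: aeW => x n _ /=; rewrite lee_fin.
rewrite /Rintegral; apply: fine_cvg; rewrite fineK//.
exact: integrable_fin_num.
Qed.

End bounded_measurable.

(** * The pointwise ergodic theorem *)

Section birkhoff.
Context d (X : measurableType d) (R : realType) (mu : probability X R).
Variable T : X -> X.
Hypothesis pT : measure_preserving mu T.

Local Notation intr f := (mu.-integrable [set: X] (EFin \o f)).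

Lemma Rintegral_indic (A : set X) (f : X -> R) :
  \int[mu]_(x in A) f x = \int[mu]_x (f x * \1_A x).
Proof.
rewrite Rintegral_mkcond; apply: eq_Rintegral => x _.
by rewrite patchE indicE; case: (x \in A); rewrite ?mulr1 ?mulr0.
Qed.

Lemma integrable_mul_indic (A : set X) (f : X -> R) : measurable A ->
  intr f -> intr (fun x => f x * \1_A x).
Proof.
move=> mA intf; apply: (le_integrable _ _ _ intf) => //.
  apply/measurable_EFinP/measurable_funM; last exact: measurable_indic.
  exact/measurable_EFinP/(measurable_int _ intf).
move=> x _; rewrite lee_fin normrM indicE.
by case: (x \in A); rewrite ?normr1 ?mulr1// normr0 mulr0.
Qed.

Lemma integrable_EFinD (f g : X -> R) : intr f -> intr g -> intr (fun x => f x + g x).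
Proof. by move=> i j; exact: (integrableD measurableT i j). Qed.

Lemma integrable_EFinB (f g : X -> R) : intr f -> intr g -> intr (fun x => f x - g x).
Proof. by move=> i j; exact: (integrableB measurableT i j). Qed.

Lemma integrable_max0 (f : X -> R) : intr f -> intr (fun x => Num.max 0 (f x)).
Proof.
move=> intf; have mf := measurable_int _ intf.
apply: (le_integrable _ _ _ intf) => //.
  by apply/measurable_EFinP/measurable_maxr => //; exact/measurable_EFinP.
move=> x _ /=; rewrite lee_fin; case: (ltP 0 (f x)) => //.
by rewrite normr0.
Qed.

(** The maximum of 0 and of the Birkhoff sums of lengths 1 to n, in the recursive form on which
    Garsia's argument rests. *)
Fixpoint max_birkhoff (g : X -> R) (n : nat) (x : X) : R :=
  if n is m.+1 then Num.max 0 (g x + max_birkhoff g m (T x)) else 0.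

Lemma max_birkhoff_ge0 g n x : 0 <= max_birkhoff g n x.
Proof. by case: n => //= n; rewrite le_max lexx. Qed.

Lemma max_birkhoffS g n x : max_birkhoff g n x <= max_birkhoff g n.+1 x.
Proof.
elim: n x => [|n IH] x; first exact: max_birkhoff_ge0.
by rewrite [leLHS]/= [leRHS]/= ge_max !le_max lexx/= lerD2l IH orbT.
Qed.

Lemma max_birkhoff_sum_le g n x :
  \sum_(0 <= k < n) g (iter k T x) <= max_birkhoff g n x.
Proof.
elim: n x => [|n IH] x; first by rewrite big_nil.
rewrite big_nat_recl//= le_max; apply/orP; right; rewrite lerD2l.
under eq_bigr do rewrite -iterS iterSr.
exact: IH.
Qed.

Lemma max_birkhoff_le_rec g n x : 0 < max_birkhoff g n x ->
  max_birkhoff g n x <= g x + max_birkhoff g n (T x).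
Proof.
case: n => [|n]; first by rewrite ltxx.
rewrite [X in 0 < X -> _]/= lt_max ltxx/= => h.
apply: (@le_trans _ _ (g x + max_birkhoff g n (T x))).
  by rewrite /= ge_max lexx (ltW h).
by rewrite lerD2l max_birkhoffS.
Qed.

Lemma integrable_max_birkhoff g n : intr g -> intr (max_birkhoff g n).
Proof.
move=> intg; elim: n => [|n IH].
  exact: (bounded_measurable_integrable mu (bounded_measurable_cst X 0)).
apply: integrable_max0; apply: integrable_EFinD => //.
exact: integrable_comp.
Qed.

(** Garsia's argument: for the maximal function M, one has M <= g + M o T where M > 0, and M = 0 <=
    M o T elsewhere. On integrating, the two integrals of M cancel because [T] preserves [mu]. *)
Lemma maximal_ergodic (g : X -> R) (n : nat) : intr g ->
  0 <= \int[mu]_(x in [set x | 0 < max_birkhoff g n x]) g x.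
Proof.
move=> intg; set E := [set x | _].
have intM := integrable_max_birkhoff n intg.
have mM : measurable_fun [set: X] (max_birkhoff g n).
  exact/measurable_EFinP/(measurable_int _ intM).
have mE : measurable E.
  rewrite (_ : E = [set: X] `&` (max_birkhoff g n) @^-1` `]0, +oo[%classic).
    by apply: mM => //; exact: measurable_itv.
  by rewrite setTI; apply/seteqP; split => x /=; rewrite in_itv/= andbT.
rewrite Rintegral_indic.
have intgE := integrable_mul_indic mE intg.
have intMT := integrable_comp pT intM.
have : \int[mu]_x max_birkhoff g n x <=
    \int[mu]_x (g x * \1_E x + max_birkhoff g n (T x)).
  apply: le_Rintegral => //; first exact: integrable_EFinD.
  move=> x _; rewrite indicE; case: (boolP (x \in E)) => [/set_mem|/negP xE].
    by rewrite mulr1 => /max_birkhoff_le_rec.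
  rewrite mulr0 add0r (le_trans _ (max_birkhoff_ge0 _ _ _))//.
  by rewrite leNgt; apply/negP => h; apply: xE; exact/mem_set.
by rewrite RintegralD// (Rintegral_comp pT intM) lerDr.
Qed.


Definition birkhoff_sum (f : X -> R) (n : nat) (x : X) : R :=
  \sum_(0 <= k < n) f (iter k T x).

Lemma birkhoff_sumS f n x : birkhoff_sum f n.+1 x = f x + birkhoff_sum f n (T x).
Proof.
rewrite /birkhoff_sum big_nat_recl//; congr (_ + _).
by apply: eq_bigr => k _; rewrite -iterSr.
Qed.

Lemma measurable_birkhoff_sum f n : measurable_fun [set: X] f ->
  measurable_fun [set: X] (birkhoff_sum f n).
Proof.
move=> mf; apply: measurable_sum => k.
by apply: measurableT_comp => //; case: (measure_preserving_iter k pT).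
Qed.

(** The set where the upper limit of the Birkhoff averages exceeds e, in countable operations. The
    slack 1/(j+1), with j free, makes it exactly invariant and not only up to a null set. *)
Let superlevel (f : X -> R) (e : R) : set X :=
  \bigcup_j \bigcap_N \bigcup_(n in [set n | (N <= n)%N])
    [set x | (e + j.+1%:R^-1) * n%:R < birkhoff_sum f n x].

Let measurable_superlevel f e : measurable_fun [set: X] f ->
  measurable (superlevel f e).
Proof.
move=> mf; apply: bigcup_measurable => j _; apply: bigcap_measurable => // N _.
apply: bigcup_measurable => n _; set c := _ * _.
rewrite (_ : [set x | _] = [set: X] `&` (birkhoff_sum f n) @^-1` `]c, +oo[%classic).
  by apply: measurable_birkhoff_sum => //; exact: measurable_itv.
by rewrite setTI; apply/seteqP; split => x /=; rewrite in_itv/= andbT.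
Qed.

Let superlevel_invariant f e x : superlevel f e (T x) <-> superlevel f e x.
Proof.
have shift (j : nat) (c : R) : exists N, forall n, (N <= n)%N ->
    c <= j.*2.+2%:R^-1 * n%:R.
  have j0 : 0 < j.*2.+2%:R^-1 :> R by rewrite invr_gt0.
  exists (Num.truncn (`|c| / j.*2.+2%:R^-1)).+1 => n nN.
  rewrite -ler_pdivrMl// mulrC.
  apply: (@le_trans _ _ (`|c| / j.*2.+2%:R^-1)).
    by apply: ler_wpM2r; [rewrite invr_ge0 ltW | exact: ler_norm].
  rewrite ltW//; apply: lt_le_trans (truncnS_gt _) _.
  by rewrite ler_nat.
have half (j : nat) : j.+1%:R^-1 = j.*2.+2%:R^-1 + j.*2.+2%:R^-1 :> R.
  by rewrite -doubleS -mul2n natrM; field.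
(* Passing between x and [T x] changes the sum and the threshold by bounded amounts. The index
   [j.*2.+1] halves the slack; the half given up, times n, outgrows these amounts. *)
split => -[j _ H]; exists (j.*2.+1) => // N _.
- have [N1 hN1] := shift j ((e + j.+1%:R^-1) - f x).
  have [n /= nN] := H (N + N1)%N I; move=> hn.
  exists n.+1 => /=; first by lia.
  have := hN1 n.+1 ltac:(lia); rewrite birkhoff_sumS.
  move: hn; rewrite half -(natr1 n).
  move: (j.*2.+2%:R^-1) (n%:R) => h m; lra.
- have [N1 hN1] := shift j (f x - (e + j.+1%:R^-1)).
  have [n /= nN] := H (N + N1).+1 I; case: n nN => // n nN; move=> hn.
  exists n => /=; first by lia.
  have := hN1 n ltac:(lia); rewrite half.
  move: hn; rewrite birkhoff_sumS half -(natr1 n).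
  move: (j.*2.+2%:R^-1) (n%:R) => h m; lra.
Qed.

(** Let D be the set where the upper limit of the averages exceeds e. The maximal inequality makes
    the integral of f - e over D nonnegative; as D is invariant, this integral is - e mu(D). Hence D
    is null. *)
Lemma birkhoff_sum_eventually_le (f : X -> R) (e : R) : intr f ->
  (forall A, invariant_sets mu T A -> \int[mu]_(x in A) f x = 0) -> 0 < e ->
  \forall x \ae mu, exists N, forall n, (N <= n)%N ->
    birkhoff_sum f n x <= (e + e) * n%:R.
Proof.
move=> intf f0 e0.
have mf : measurable_fun [set: X] f by exact/measurable_EFinP/(measurable_int _ intf).
set D := superlevel f e.
have mD : measurable D by exact: measurable_superlevel.
have TD : T @^-1` D = D 
  by apply/seteqP; split => x; have [h1 h2] := superlevel_invariant f e x.
have invD : invariant_sets mu T D by split => //; rewrite TD setYK measure0.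
have DT k x : (iter k T x \in D) = (x \in D).
  elim: k => //= k <-; apply/idP/idP => /set_mem h; apply/mem_set.
  - by apply/superlevel_invariant.
  - by apply/(superlevel_invariant f e).
(* Truncating to the invariant set [D] makes every point of [D] a point of
   positivity for the maximal function, so the maximal inequality holds on all
   of [D]. *)
pose g x := (f x - e) * \1_D x.
have intg : intr g.
  apply: integrable_mul_indic => //; apply: integrable_EFinB => //.
  exact: (bounded_measurable_integrable mu (bounded_measurable_cst X e)).
have mg : measurable_fun [set: X] g by exact/measurable_EFinP/(measurable_int _ intg).
have sumg n x : x \in D -> birkhoff_sum g n x = birkhoff_sum f n x - e * n%:R.
  move=> xD; rewrite /birkhoff_sum; under eq_bigr do rewrite /g indicE DT xD mulr1.
  by rewrite sumrB big_const_nat subn0 iter_addr_0 mulr_natr.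
pose E n := [set x | 0 < max_birkhoff g n x].
have ED n x : x \notin D -> max_birkhoff g n x = 0.
  elim: n x => //= n IH x xD; rewrite IH ?DT ?(DT 1%N)// /g indicE (negbTE xD).
  by rewrite mulr0 addr0 maxxx.
have cvgE x : g x * \1_(E n) x @[n --> \oo] --> g x.
  have [xD|xD] := boolP (x \in D); last first.
    rewrite /g indicE (negbTE xD) mulr0; under eq_fun do rewrite mul0r.
    exact: cvg_cst.
  have [j _ Hj] := set_mem xD.
  have [n /= n1 hn] := Hj 1%N I.
  have gn : 0 < birkhoff_sum g n x.
    rewrite sumg// subr_gt0; apply: le_lt_trans hn.
    by rewrite ler_wpM2r// lerDl invr_ge0.
  apply: cvg_near_cst; exists n => // m /= nm; rewrite indicE.
  suff -> : x \in E m by rewrite mulr1.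
  apply: mem_set => /=; apply: (lt_le_trans gn).
  have h0 : birkhoff_sum g n x <= max_birkhoff g n x by exact: max_birkhoff_sum_le.
  apply: (le_trans h0).
  elim: m nm => [|m IH]; first by rewrite leqn0 => /eqP ->.
  rewrite leq_eqVlt => /predU1P[->//|/IH h].
  exact: le_trans h (max_birkhoffS _ _ _).
have mE n : measurable (E n).
  rewrite (_ : E n = [set: X] `&` (max_birkhoff g n) @^-1` `]0, +oo[%classic).
    have mM := measurable_int _ (integrable_max_birkhoff n intg).
    by move/measurable_EFinP : mM; apply => //; exact: measurable_itv.
  by rewrite setTI; apply/seteqP; split => x /=; rewrite in_itv/= andbT.
have g0 : 0 <= \int[mu]_x g x.
  have lim : \int[mu]_x (g x * \1_(E n) x) @[n --> \oo] --> \int[mu]_x g x.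
    apply: (@Rintegral_dominated_cvg _ _ _ mu _ _ (fun x => `|g x|)) => //.
    - by move=> n; apply: measurable_funM => //; exact: measurable_indic.
    - exact: aeW.
    - exact: (integrable_norm intg).
    - move=> n x; rewrite normrM ler_piMr// indicE.
      by case: (_ \in _); rewrite ?normr1 ?normr0.
  apply: (cvgr_to_ge lim); apply: nearW => n.
  by rewrite -Rintegral_indic; exact: maximal_ergodic.
have muD : mu D = 0%E.
  move: g0; rewrite -Rintegral_indic RintegralB//.
  + rewrite f0// sub0r oppr_ge0 Rintegral_cst// pmulr_rle0// => muD.
    apply/eqP; rewrite eq_le measure_ge0 andbT -[leLHS]fineK ?fin_num_measure//.
  + by apply: integrableS intf.
  + apply: integrableS (bounded_measurable_integrable mu (bounded_measurable_cst X e)) => //.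
(* Off D the averages are eventually at most e + 1/(j+1), for every j. The j chosen here makes
   1/(j+1) at most e, whence [e + e]. *)
exists D; split => // x /= nP; exists (Num.truncn e^-1) => // N _.
apply: contrapT => nN; apply: nP; exists N => n Nn.
rewrite leNgt; apply/negP => hn; apply: nN; exists n => //=.
apply: le_lt_trans hn; apply: ler_wpM2r => //; rewrite lerD2l.
by rewrite -[leRHS]invrK lef_pV2 ?posrE ?invr_gt0// ltW// truncnS_gt.
Qed.

Lemma birkhoff_avg_cvg0 (f : X -> R) : intr f ->
  (forall A, invariant_sets mu T A -> \int[mu]_(x in A) f x = 0) ->
  \forall x \ae mu, n%:R^-1 * birkhoff_sum f n x @[n --> \oo] --> 0.
Proof.
move=> intf f0.
have intNf : intr (fun x => - f x) by exact: (integrableN intf).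
have Nf0 A : invariant_sets mu T A -> \int[mu]_(x in A) - f x = 0.
  move=> IA; have [mA _] := IA.
  under eq_Rintegral do rewrite -mulN1r.
  by rewrite RintegralZl ?f0 ?mulr0//; exact: integrableS intf.
have upper := ae_foralln (fun j : nat =>
  birkhoff_sum_eventually_le intf f0 (e := j.+1%:R^-1) ltac:(by rewrite invr_gt0)).
have lower := ae_foralln (fun j : nat =>
  birkhoff_sum_eventually_le intNf Nf0 (e := j.+1%:R^-1) ltac:(by rewrite invr_gt0)).
apply: filterS2 upper lower => x up lo.
apply/cvgr0Pnorm_le => e e0; pose j := Num.truncn (e / 2)^-1.
have je : j.+1%:R^-1 <= e / 2.
  by rewrite -[leRHS]invrK lef_pV2 ?posrE ?invr_gt0 ?divr_gt0// ltW// truncnS_gt.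
have [N1 h1] := up j; have [N2 h2] := lo j.
exists (maxn N1 N2).+1 => // n /= nN.
have n0 : 0 < n%:R :> R by rewrite ltr0n; lia.
rewrite normrM gtr0_norm ?invr_gt0// ler_pdivrMl// ler_norml.
have := h1 n ltac:(lia); have := h2 n ltac:(lia).
have -> : birkhoff_sum (fun x => - f x) n x = - birkhoff_sum f n x.
  by rewrite /birkhoff_sum sumrN.
have h : (j.+1%:R^-1 + j.+1%:R^-1) * n%:R <= n%:R * e.
  by rewrite mulrC ler_wpM2l// [leRHS](splitr e) lerD.
by move=> a b; rewrite lerNl (le_trans a)//= (le_trans b).
Qed.

Lemma sub_invariant_measurable : invariant_sets mu T `<=` measurable.
Proof. by move=> A []. Qed.

Lemma cond_exp_invariantP f : intr f ->
  is_cond_exp mu (invariant_sets mu T) f (cond_exp mu (invariant_sets mu T) f).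
Proof.
move=> intf; apply: cond_expP => //; last exact: sub_invariant_measurable.
by apply: sigma_algebra_invariant_sets; case: pT.
Qed.

(** Members of [invariant_sets] are invariant only up to null sets. For each rational q the set
    where h < q thus agrees almost everywhere with its preimage, and countably many rationals
    suffice to separate h from h o T. *)
Lemma cond_exp_invariant f : intr f ->
  \forall x \ae mu, forall k, cond_exp mu (invariant_sets mu T) f (iter k T x) =
    cond_exp mu (invariant_sets mu T) f x.
Proof.
move=> /cond_exp_invariantP[hI _ _].
set h := cond_exp _ _ _ in hI *.
have aeq (q : rat) : \forall x \ae mu, (h x < ratr q) = (h (T x) < ratr q).
  have /= [mA A0] := hI _ (measurable_itv `]-oo, (ratr q : R)[).
  set A := h @^-1` _ in mA A0.
  have mTA : measurable (T @^-1` A).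
    by rewrite -[X in measurable X]setTI; case: pT => mT _; exact: mT.
  exists (A `+` T @^-1` A); split => //.
    by apply: measurableU; exact: measurableD.
  move=> x hx; rewrite setY_def /A.
  move: hx; rewrite /setU/setD/preimage/= !in_itv/=.
  by case: ltP => hx; case: ltP => hTx //= _; [left|right].
have hT : \forall x \ae mu, h (T x) = h x.
  have /ae_foralln := fun n => aeq (odflt 0 (unpickle n)).
  apply: filterS => x hx.
  have {}hx q : (h x < ratr q) = (h (T x) < ratr q).
    by have := hx (pickle q); rewrite pickleK.
  apply/eqP; rewrite eq_le; apply/andP; split; rewrite leNgt; apply/negP => /rat_in_itvoo[q].
  - rewrite in_itv/= => /andP[h1 h2]; move: h1; rewrite hx => /lt_trans/(_ h2).
    by rewrite ltxx.
  - rewrite in_itv/= => /andP[h1 h2]; move: h1; rewrite -hx => /lt_trans/(_ h2).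
    by rewrite ltxx.
apply: filterS (ae_iter pT hT) => x hx; elim => //= k IH.
by rewrite hx.
Qed.

(** With h the conditional expectation, f - h integrates to 0 over invariant sets, so its averages
    vanish in the limit; h is constant along almost every orbit and equals its own averages. *)
Lemma birkhoff (f : X -> R) : intr f ->
  \forall x \ae mu, n%:R^-1 * birkhoff_sum f n x @[n --> \oo] -->
    cond_exp mu (invariant_sets mu T) f x.
Proof.
move=> intf; have [_ inth hf] := cond_exp_invariantP intf.
have inv := cond_exp_invariant intf.
set h := cond_exp _ _ _ in inth hf inv *.
have int0 A : invariant_sets mu T A -> \int[mu]_(x in A) (f x - h x) = 0.
  move=> IA; have [mA _] := IA.
  rewrite RintegralB//; first by rewrite hf// subrr.
  - exact: integrableS intf.
  - exact: integrableS inth.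
apply: filterS2 inv (birkhoff_avg_cvg0 (integrable_EFinB intf inth) int0) => x hx lim.
rewrite -[h x]add0r.
apply: cvg_trans (cvgD lim (cvg_cst (h x))).
apply: near_eq_cvg; exists 1%N => // n /= n1.
have E : birkhoff_sum (fun x => f x - h x) n x = birkhoff_sum f n x - n%:R * h x.
  rewrite /birkhoff_sum sumrB; congr (_ - _).
  by under eq_bigr do rewrite hx; rewrite big_const_nat subn0 iter_addr_0 mulr_natl.
rewrite !fctE/= E mulrBr mulKf ?subrK//.
by rewrite pnatr_eq0; lia.
Qed.

End birkhoff.

(** * The van der Corput bound *)

Section van_der_corput.
Context d (X : measurableType d) (R : realType) (mu : probability X R).
Variables (T1 T2 : X -> X) (f1 f2 : X -> R).
Hypothesis pT1 : measure_preserving mu T1.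
Hypothesis pT2 : measure_preserving mu T2.
Hypothesis TC : forall x, T1 (T2 x) = T2 (T1 x).
Hypothesis mf1 : measurable_fun [set: X] f1.
Hypothesis mf2 : measurable_fun [set: X] f2.
Hypothesis f1_le1 : forall x, `|f1 x| <= 1.
Hypothesis f2_le1 : forall x, `|f2 x| <= 1.
Variables (z : nat -> R) (s : nat -> nat).
Hypothesis z_le1 : forall k, `|z k| <= 1.
Hypothesis s_step : forall k, (s k <= s k.+1 <= (s k).+1)%N.
Variables (N M1 B1 M2 B2 : nat).
Hypothesis NE1 : N = (M1 * B1)%N.
Hypothesis NE2 : N = (M2 * B2)%N.
Variables (l1 l2 : R).
Hypothesis l1_gt0 : 0 < l1.
Hypothesis l2_gt0 : 0 < l2.

(** The coefficients left by [block_sqr_sum_le] at lag [m]; [vdc_coef2] comes from applying it once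
    more, at lag [h], to these. *)
Definition vdc_coef1 (m k : nat) : R := (k %% M1 + m < M1)%N%:R * (z k * z (k + m)%N).

Definition vdc_coef2 (m h k : nat) : R :=
  (k %% M2 + h < M2)%N%:R * (vdc_coef1 m k * vdc_coef1 m (k + h)).

(* The exponents of [T1] in the integral of the product of the terms of [H]
   (below) at times k and k + h, after composing with a power of [T1]: that
   integral only depends on k through this triple. *)
Definition vdc_shift (m h k : nat) : nat * nat * nat :=
  (s (k + m) - s k, s (k + h) - s k, s (k + h + m) - s (k + h))%N.

(** Times with equal shifts carry the same integral, so their coefficients are added up. As [s]
    grows by at most one per step, a shift over a lag below [M1] or [M2] stays below it, and every
    triple that occurs lies in this finite type. *)
Definition vdc_corr (m h : nat) (t : 'I_M1 * 'I_M2 * 'I_M1) : R :=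
  \sum_(0 <= k < N)
    (vdc_shift m h k == (t.1.1 : nat, t.1.2 : nat, t.2 : nat))%:R * vdc_coef2 m h k.

(** No trace of the space or of [f1], [f2] remains. The two diagonals are the sum of the z^2 and
    [N]; [l1] and [l2] are the constants of [young_mul]; [M1 * M2 * M1] counts the triples. *)
Definition vdc_bound : R :=
  B1%:R * (\sum_(0 <= k < N) z k ^+ 2 + \sum_(1 <= m < M1)
    (l1 + B2%:R * (N%:R + \sum_(1 <= h < M2)
      (l2 * (M1 * M2 * M1)%:R + (\sum_t vdc_corr m h t ^+ 2) / l2)) / l1)).

Let sD k m : (s k <= s (k + m) <= s k + m)%N.
Proof.
elim: m => [|m IH]; first by rewrite !addn0 leqnn.
by have := s_step (k + m); rewrite -addnS; lia.
Qed.

Let b1 a b : bounded_measurable (fun x => f1 (iter a T1 (iter b T2 x))).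
Proof.
split; last by exists 1.
apply: measurableT_comp => //.
have [m1 _] := measure_preserving_iter a pT1.
have [m2 _] := measure_preserving_iter b pT2.
exact: measurableT_comp.
Qed.

Let b2 b : bounded_measurable (fun x => f2 (iter b T2 x)).
Proof.
split; last by exists 1.
by apply: measurableT_comp => //; have [] := measure_preserving_iter b pT2.
Qed.

Let iterC a b x : iter a T1 (iter b T2 x) = iter b T2 (iter a T1 x).
Proof.
have T1C n y : T1 (iter n T2 y) = iter n T2 (T1 y).
  by elim: n => //= n IH; rewrite TC IH.
by elim: a => //= a ->; rewrite T1C.
Qed.

Lemma normrM_le1 (x y : R) : `|x| <= 1 -> `|y| <= 1 -> `|x * y| <= 1.
Proof. by move=> hx hy; rewrite normrM mulr_ile1. Qed.

Lemma sqr_le1 (x : R) : `|x| <= 1 -> x ^+ 2 <= 1.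
Proof. by move=> hx; rewrite -real_normK ?num_real// expr_le1. Qed.

Let coef1_le1 m k : `|vdc_coef1 m k| <= 1.
Proof.
apply: normrM_le1; last exact: normrM_le1.
by rewrite normr_nat lern1 leq_b1.
Qed.

Let H m x := \sum_(0 <= k < N) vdc_coef1 m k *
  (f1 (iter (s k) T1 (iter (N - k) T2 x)) *
   f1 (iter (s (k + m)) T1 (iter (N - k) T2 x))).

Let V x := \sum_(0 <= k < N) z k * (f1 (iter (s k) T1 x) * f2 (iter k T2 x)).

Let b10 a : bounded_measurable (fun x => f1 (iter a T1 x)).
Proof. exact: (b1 a 0). Qed.

Let bV : bounded_measurable V.
Proof.
apply: bounded_measurable_sum => k _; apply: bounded_measurableZ.
exact: bounded_measurableM.
Qed.

Let bH m : bounded_measurable (H m).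
Proof.
apply: bounded_measurable_sum => k _; apply: bounded_measurableZ.
exact: bounded_measurableM.
Qed.

(* Composing the k-th term with T2^(N-k) makes the factor in [f2] independent
   of k, so that it can be removed by [young_mul]. *)
Let V_le : \int[mu]_x V x ^+ 2 <=
  B1%:R * (\sum_(0 <= k < N) z k ^+ 2 + \sum_(1 <= m < M1)
    (l1 + (\int[mu]_x H m x ^+ 2) / l1)).
Proof.
pose g k x := z k * (f1 (iter (s k) T1 x) * f2 (iter k T2 x)).
have bg k : bounded_measurable (g k).
  by apply: bounded_measurableZ; exact: bounded_measurableM.
have bgg m k : bounded_measurable
    (fun x => (k %% M1 + m < M1)%N%:R * (g k x * g (k + m)%N x)).
  by apply: bounded_measurableZ; exact: bounded_measurableM.
have bS : bounded_measurable (fun x => \sum_(0 <= k < N) g k x ^+ 2).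
  by apply: bounded_measurable_sum => k _; exact: bounded_measurableX.
have bSS : bounded_measurable (fun x => \sum_(1 <= m < M1) \sum_(0 <= k < N)
    (k %% M1 + m < M1)%N%:R * (g k x * g (k + m)%N x)).
  by apply: bounded_measurable_sum => m _; exact: bounded_measurable_sum.
apply: (@le_trans _ _ (\int[mu]_x (B1%:R * (\sum_(0 <= k < N) g k x ^+ 2 +
    2 * \sum_(1 <= m < M1) \sum_(0 <= k < N)
      (k %% M1 + m < M1)%N%:R * (g k x * g (k + m)%N x))))).
  apply: ler_Rintegral; first exact: bounded_measurableX.
    apply: bounded_measurableZ; apply: bounded_measurableD => //.
    exact: bounded_measurableZ.
  by move=> x; rewrite /V NE1; exact: block_sqr_sum_le.
rewrite RintegralZ_bounded; last first.
  by apply: bounded_measurableD => //; exact: bounded_measurableZ.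
rewrite RintegralD_bounded//; last exact: bounded_measurableZ.
rewrite RintegralZ_bounded// !Rintegral_sum; last 2 first.
- by move=> m _; exact: bounded_measurable_sum.
- by move=> k _; exact: bounded_measurableX.
apply: ler_wpM2l => //; apply: lerD.
  apply: ler_sum => k _; apply: le_trans (ler_norm _) _.
  apply: Rintegral_norm_le; first exact: bounded_measurableX.
  move=> x; rewrite exprMn normrM ger0_norm ?sqr_ge0// ler_piMr ?sqr_ge0//.
  by rewrite ger0_norm ?sqr_ge0// sqr_le1// normrM_le1.
rewrite mulr_sumr; apply: ler_sum => m _.
rewrite Rintegral_sum//.
pose phi x := f2 (iter N T2 x) * f2 (iter (N + m) T2 x).
have bphi : bounded_measurable phi by exact: bounded_measurableM.
have -> : \sum_(0 <= k < N) \int[mu]_x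
    ((k %% M1 + m < M1)%N%:R * (g k x * g (k + m)%N x)) =
    \int[mu]_x (phi x * H m x).
  under [RHS]eq_Rintegral do rewrite mulr_sumr.
  rewrite Rintegral_sum; last first.
    move=> k _; apply: bounded_measurableM => //; apply: bounded_measurableZ.
    exact: bounded_measurableM.
  apply: eq_big_nat => k /andP[_ kN].
  rewrite -(Rintegral_comp (measure_preserving_iter (N - k) pT2)); last first.
    exact: bounded_measurable_integrable.
  apply: eq_Rintegral => x _; rewrite /g /phi /vdc_coef1.
  rewrite -!iterD subnKC; last exact: ltnW.
  rewrite (_ : (k + m + (N - k) = N + m)%N); last by lia.
  ring.
rewrite -(RintegralZ_bounded mu 2 (bounded_measurableM bphi (bH m))).
apply: (@le_trans _ _ (\int[mu]_x (l1 + l1^-1 * H m x ^+ 2))).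
  apply: ler_Rintegral.
  - by apply: bounded_measurableZ; exact: bounded_measurableM.
  - apply: bounded_measurableD; first exact: bounded_measurable_cst.
    by apply: bounded_measurableZ; exact: bounded_measurableX.
  - by move=> x; rewrite [_^-1 * _]mulrC; apply: young_mul => //; exact: normrM_le1.
rewrite RintegralD_bounded; last 2 first.
- exact: bounded_measurable_cst.
- by apply: bounded_measurableZ; exact: bounded_measurableX.
rewrite Rintegral_prob_cst RintegralZ_bounded; last exact: bounded_measurableX.
by rewrite mulrC.
Qed.

(** Up to coefficients, the product of the terms of [H] at times k and k + h is this function
    composed with T1^(s k) o T2^(N - (k + h)). Commutation of [T1] and [T2] is what allows this map
    to be pulled out. *)
Let kernel h (t : nat * nat * nat) x :=
  f1 (iter h T2 x) * f1 (iter t.1.1 T1 (iter h T2 x)) *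
  (f1 (iter t.1.2 T1 x) * f1 (iter (t.1.2 + t.2) T1 x)).

Let bkernel h t : bounded_measurable (kernel h t).
Proof.
apply: bounded_measurableM; last exact: bounded_measurableM.
by apply: bounded_measurableM => //; exact: (b1 0).
Qed.

Let kernel_le1 h t : `|\int[mu]_x kernel h t x| <= 1.
Proof.
apply: Rintegral_norm_le => // x.
by apply: normrM_le1; exact: normrM_le1.
Qed.

(** [F] will be the integral of the kernel, of which only a bound by 1 is known. Grouping by triple
    replaces [N] unknown numbers by [M1 * M2 * M1], few enough to apply [young_mul] to each. *)
Let sum_by_shift m h (F : nat * nat * nat -> R) : (m < M1)%N -> (h < M2)%N ->
  \sum_(0 <= k < N) vdc_coef2 m h k * F (vdc_shift m h k) =
  \sum_(t : 'I_M1 * 'I_M2 * 'I_M1) F (t.1.1 : nat, t.1.2 : nat, t.2 : nat) *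
    vdc_corr m h t.
Proof.
move=> mM hM.
under [RHS]eq_bigr do rewrite /vdc_corr mulr_sumr.
rewrite exchange_big/=; apply: eq_bigr => k _.
have u1 : (s (k + m) - s k < M1)%N by have := sD k m; lia.
have u2 : (s (k + h) - s k < M2)%N by have := sD k h; lia.
have u3 : (s (k + h + m) - s (k + h) < M1)%N by have := sD (k + h) m; lia.
rewrite (bigD1 (Ordinal u1, Ordinal u2, Ordinal u3))//= /vdc_shift eqxx mul1r.
rewrite [X in _ + X]big1 ?addr0 1?mulrC// => -[[a b] c]/= ne.
rewrite (_ : (_ == _) = false) ?mul0r ?mulr0//; apply/negbTE.
apply: contra ne; rewrite !xpair_eqE -!val_eqE/= => /andP[/andP[/eqP-> /eqP->] /eqP->].
by rewrite !eqxx.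
Qed.

Let H_le m : (m < M1)%N -> \int[mu]_x H m x ^+ 2 <=
  B2%:R * (N%:R + \sum_(1 <= h < M2)
      (l2 * (M1 * M2 * M1)%:R + (\sum_t vdc_corr m h t ^+ 2) / l2)).
Proof.
move=> mM; pose g k x := vdc_coef1 m k *
  (f1 (iter (s k) T1 (iter (N - k) T2 x)) *
   f1 (iter (s (k + m)) T1 (iter (N - k) T2 x))).
have bg k : bounded_measurable (g k).
  by apply: bounded_measurableZ; exact: bounded_measurableM.
have bgg h k : bounded_measurable
    (fun x => (k %% M2 + h < M2)%N%:R * (g k x * g (k + h)%N x)).
  by apply: bounded_measurableZ; exact: bounded_measurableM.
have bS : bounded_measurable (fun x => \sum_(0 <= k < N) g k x ^+ 2).
  by apply: bounded_measurable_sum => k _; exact: bounded_measurableX.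
have bSS : bounded_measurable (fun x => \sum_(1 <= h < M2) \sum_(0 <= k < N)
    (k %% M2 + h < M2)%N%:R * (g k x * g (k + h)%N x)).
  by apply: bounded_measurable_sum => h _; exact: bounded_measurable_sum.
apply: (@le_trans _ _ (\int[mu]_x (B2%:R * (\sum_(0 <= k < N) g k x ^+ 2 +
    2 * \sum_(1 <= h < M2) \sum_(0 <= k < N)
      (k %% M2 + h < M2)%N%:R * (g k x * g (k + h)%N x))))).
  apply: ler_Rintegral; first exact: bounded_measurableX.
    apply: bounded_measurableZ; apply: bounded_measurableD => //.
    exact: bounded_measurableZ.
  by move=> x; have := block_sqr_sum_le (fun k => g k x) M2 B2; rewrite -NE2.
rewrite RintegralZ_bounded; last first.
  by apply: bounded_measurableD => //; exact: bounded_measurableZ.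
rewrite RintegralD_bounded//; last exact: bounded_measurableZ.
rewrite RintegralZ_bounded// !Rintegral_sum; last 2 first.
- by move=> h _; exact: bounded_measurable_sum.
- by move=> k _; exact: bounded_measurableX.
apply: ler_wpM2l => //; apply: lerD.
  rewrite -[X in _ <= X%:R]subn0 -sumr_const_nat.
  apply: ler_sum => k _; apply: le_trans (ler_norm _) _.
  apply: Rintegral_norm_le; first exact: bounded_measurableX.
  move=> x; rewrite ger0_norm ?sqr_ge0// sqr_le1//.
  by apply: normrM_le1 => //; exact: normrM_le1.
rewrite mulr_sumr big_nat_cond [leRHS]big_nat_cond.
apply: ler_sum => h /andP[/andP[h1 hM] _]; rewrite Rintegral_sum//.
have -> : \sum_(0 <= k < N) \int[mu]_x
    ((k %% M2 + h < M2)%N%:R * (g k x * g (k + h)%N x)) =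
    \sum_(0 <= k < N) vdc_coef2 m h k * \int[mu]_x kernel h (vdc_shift m h k) x.
  apply: eq_big_nat => k /andP[_ kN]; rewrite /vdc_coef2.
  case: ltnP => [wk|_]; last first.
    under eq_Rintegral do rewrite mul0r.
    by rewrite Rintegral_prob_cst !mul0r.
  (* The indicator keeps k + h in the block of k, and [N] is a multiple of [M2]; hence the truncated
     subtraction [N - (k + h)] is exact. *)
  have khN : (k + h < N)%N.
    have kB : (k %/ M2 < B2)%N by rewrite ltn_divLR ?(leq_ltn_trans _ hM)// mulnC -NE2.
    have := leq_mul (leqnn M2) kB; rewrite -NE2 mulnS.
    by rewrite {2}(divn_eq k M2) mulnC; lia.
  rewrite -(RintegralZ_bounded mu _ (bkernel _ _)).
  have pk := measure_preserving_comp (measure_preserving_iter (s k) pT1)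
    (measure_preserving_iter (N - (k + h)) pT2).
  rewrite -[RHS](Rintegral_comp pk)/=; last first.
    by apply: bounded_measurable_integrable; exact: bounded_measurableZ.
  apply: eq_Rintegral => x _; rewrite /g /kernel /vdc_shift/=.
  rewrite -!iterC -!iterD.
  have := sD k m; have := sD k h; have := sD (k + h) m => e1 e2 e3.
  rewrite (_ : h + (N - (k + h)) = N - k)%N; last by lia.
  rewrite (_ : s (k + m) - s k + s k = s (k + m))%N; last by lia.
  rewrite (_ : s (k + h) - s k + s k = s (k + h))%N; last by lia.
  rewrite (_ : s (k + h) - s k + (s (k + h + m) - s (k + h)) + s k =
    s (k + h + m))%N; last by lia.
  ring.
rewrite (sum_by_shift (fun t => \int[mu]_x kernel h t x))// mulr_sumr.
have -> : l2 * (M1 * M2 * M1)%:R = \sum_(t : 'I_M1 * 'I_M2 * 'I_M1) l2.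
  by rewrite sumr_const !card_prod !card_ord mulr_natr.
rewrite mulr_suml -big_split/=; apply: ler_sum => t _.
exact: young_mul.
Qed.

Lemma van_der_corput_bound :
  \int[mu]_x (\sum_(0 <= k < N) z k * (f1 (iter (s k) T1 x) * f2 (iter k T2 x))) ^+ 2 <=
  vdc_bound.
Proof.
apply: (le_trans V_le); apply: ler_wpM2l => //; rewrite lerD2l.
rewrite big_nat_cond [leRHS]big_nat_cond.
apply: ler_sum => m /andP[/andP[_ mM] _]; rewrite lerD2l.
by rewrite ler_pM2r ?invr_gt0//; exact: H_le.
Qed.

End van_der_corput.

(** * Limits of real sequences *)

Lemma cvgD_eq (R : realType) (f g h : nat -> R) (a b c : R) :
  f n @[n --> \oo] --> a -> g n @[n --> \oo] --> b -> c = a + b ->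
  (forall n, h n = f n + g n) -> h n @[n --> \oo] --> c.
Proof. by move=> fa gb -> /funext ->; exact: cvgD. Qed.

Lemma cvg_subseq (V : topologicalType) (f : nat -> V) (l : V) (u : nat -> nat) :
  (forall j, (j <= u j)%N) -> f n @[n --> \oo] --> l -> f (u j) @[j --> \oo] --> l.
Proof.
by move=> uj fl A /fl[N _ hN]; exists N => // j Nj; apply: hN; exact: leq_trans (uj j).
Qed.

Lemma cvgZ_eq (R : realType) (f h : nat -> R) (k a c : R) :
  f n @[n --> \oo] --> a -> c = k * a ->
  (forall n, h n = k * f n) -> h n @[n --> \oo] --> c.
Proof. by move=> fa -> /funext ->; exact: cvgM (cvg_cst k) fa. Qed.

Lemma sqr_cvg0 (R : realType) (f : nat -> R) :
  f n ^+ 2 @[n --> \oo] --> 0 -> f n @[n --> \oo] --> 0.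
Proof.
move=> f2; apply/cvgr0Pnorm_le => e e0.
have e20 : 0 < e ^+ 2 by rewrite exprn_gt0.
have [N _ hN] : \forall j \near \oo, `|f j ^+ 2| <= e ^+ 2 by exact: cvgr0_norm_le.
exists N => // j /hN; rewrite ger0_norm ?sqr_ge0//.
by rewrite -[X in X <= _]real_normK ?num_real// ler_pXn2r ?nnegrE// ltW.
Qed.

Lemma sum_inv_sqr_le (R : realFieldType) n :
  \sum_(0 <= j < n) (j.+1%:R ^+ 2)^-1 <= 2 :> R.
Proof.
case: n => [|n]; first by rewrite big_geq.
suff : \sum_(0 <= j < n.+1) (j.+1%:R ^+ 2)^-1 <= 2 - n.+1%:R^-1 :> R.
  by move=> h; apply: (le_trans h); rewrite gerBl.
elim: n => [|n IH]; first by rewrite big_nat1 expr1n invr1; lra.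
rewrite big_nat_recr//=; apply: (le_trans (lerD IH (lexx _))).
have a0 : 0 < n.+1%:R :> R by [].
rewrite -[n.+2%:R]natr1; set a := n.+1%:R in a0 *.
have a1 : 0 < a + 1 by rewrite addr_gt0.
rewrite -subr_ge0.
rewrite (_ : _ - _ = (a * (a + 1) ^+ 2)^-1); last by field; rewrite !gt_eqF.
by rewrite invr_ge0 mulr_ge0 ?sqr_ge0 ?ltW.
Qed.

Lemma ge0_bounded_series_cvg0 (R : realType) (x : nat -> R) (C : R) :
  (forall j, 0 <= x j) -> (forall J, \sum_(0 <= j < J) x j <= C) ->
  x j @[j --> \oo] --> 0.
Proof.
move=> x0 xC; apply: cvg_series_cvg_0.
apply: nondecreasing_is_cvgn.
  apply/nondecreasing_seqP => n; rewrite /series/= big_nat_recr//= lerDl//.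
by exists C => _ [J _ <-]; exact: xC.
Qed.

(** Between u j and u (j+1), [E] moves by at most the increments of the monotone sequences [c] and
    [W], and the last two limits make both increments o(W (u j)). *)
Lemma interpolation_cvg0 (R : realType) (W E c : nat -> R) (u : nat -> nat) :
  0 < W (u 0%N) -> {homo W : m n / (m <= n)%N >-> m <= n} ->
  {homo c : m n / (m <= n)%N >-> m <= n} ->
  (forall m n, (m <= n)%N -> `|E n - E m| <= (c n - c m) + (W n - W m)) ->
  (forall j, (u j < u j.+1)%N) ->
  E (u j) / W (u j) @[j --> \oo] --> 0 ->
  c (u j) / W (u j) @[j --> \oo] --> (1 : R) ->
  W (u j.+1) / W (u j) @[j --> \oo] --> (1 : R) ->
  E n / W n @[n --> \oo] --> 0.
Proof.
move=> W0 ndW ndc EcW incu E0 c1 W1.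
have u_ge j : (j <= u j)%N by elim: j => // j; have := incu j; lia.
have ndu : {homo u : m n / (m <= n)%N}.
  by apply: homo_leq => [//|m n k|n]; [exact: leq_trans | exact: ltnW].
have Wu j : 0 < W (u j) by rewrite (lt_le_trans W0)// ndW// ndu.
pose r j := W (u j.+1) / W (u j).
(* Written with ratios so that the limit can be read off; [delE] identifies it with the bound for |E
   n|, divided by W (u j). *)
pose del j := `|E (u j) / W (u j)| +
  (r j * (c (u j.+1) / W (u j.+1)) - c (u j) / W (u j)) + (r j - 1).
have del0 : del j @[j --> \oo] --> 0.
  suff : del j @[j --> \oo] --> `|0 : R| + (1 * 1 - 1) + (1 - 1).
    by rewrite normr0 mul1r subrr !addr0.
  apply: cvgD; last by apply: cvgB => //; exact: cvg_cst.
  apply: cvgD; first exact: cvg_norm.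
  apply: cvgB => //; apply: cvgM => //.
  have := c1; rewrite -(cvg_shiftS (fun j => c (u j) / W (u j))); exact.
apply/cvgr0Pnorm_le => e e0.
have [j0 _ hj0] : \forall j \near \oo, `|del j| <= e by exact: cvgr0_norm_le.
exists (u j0) => // n /= nj0.
have [j [j0j ujn nuj]] : exists j, [/\ (j0 <= j)%N, (u j <= n)%N & (n < u j.+1)%N].
  have ex : exists i, (u i <= n)%N by exists j0.
  have bd i : (u i <= n)%N -> (i <= n)%N by exact: leq_trans.
  case: (ex_maxnP ex bd) => j uj jmax; exists j; split => //; first exact: jmax.
  by rewrite ltnNge; apply/negP => /jmax; rewrite ltnn.
apply: le_trans (le_trans (ler_norm _) (hj0 _ j0j)).
have Wn : W (u j) <= W n by exact: ndW.
have Wn0 : 0 < W n by exact: lt_le_trans Wn.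
rewrite normrM normfV (gtr0_norm Wn0).
have h : `|E n| <= `|E (u j)| + (c (u j.+1) - c (u j)) + (W (u j.+1) - W (u j)).
  rewrite -{1}(subrK (E (u j)) (E n)) addrC (le_trans (ler_normD _ _))// -addrA lerD2l.
  apply: (le_trans (EcW _ _ ujn)).
  by apply: lerD; rewrite lerD2r; [apply: ndc|apply: ndW]; exact: ltnW.
have delE : del j =
    (`|E (u j)| + (c (u j.+1) - c (u j)) + (W (u j.+1) - W (u j))) / W (u j).
  rewrite /del /r normrM normfV (gtr0_norm (Wu j)); field.
  by rewrite !gt_eqF.
rewrite delE; apply: (@le_trans _ _ (`|E n| / W (u j))).
  by rewrite ler_wpM2l// lef_pV2 ?posrE.
by rewrite ler_pM2r ?invr_gt0.
Qed.

(** Summation by parts: the partial sums [D] of v - u are nonnegative and the weights decrease. The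
    induction carries the boundary term [sg N * D N]. *)
Lemma ler_sum_decreasing_weight (R : realDomainType) (sg u v : nat -> R) (N : nat) :
  (forall k, 0 <= sg k) -> (forall k, (0 < k)%N -> sg k.+1 <= sg k) ->
  (forall n, \sum_(1 <= k < n.+1) u k <= \sum_(1 <= k < n.+1) v k) ->
  \sum_(1 <= k < N.+1) sg k * u k <= \sum_(1 <= k < N.+1) sg k * v k.
Proof.
move=> sg0 sgS uv; pose D n := \sum_(1 <= k < n.+1) (v k - u k).
have D0 n : 0 <= D n by rewrite /D sumrB subr_ge0.
rewrite -subr_ge0 -sumrB; under eq_bigr do rewrite -mulrBr.
suff : sg N * D N <= \sum_(1 <= k < N.+1) sg k * (v k - u k).
  by apply: le_trans; exact: mulr_ge0.
elim: N => [|N IH]; first by rewrite /D !big_geq// mulr0.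
rewrite [leRHS]big_nat_recr//= {1}/D big_nat_recr//= mulrDr lerD2r.
case: N IH => [|N] IH; first by rewrite !big_geq// mulr0.
by apply: le_trans IH; rewrite ler_wpM2r// ?sgS//; exact: D0.
Qed.

(** * Densities and slowly varying weights *)

Definition hits (w : nat -> bool) (n : nat) : nat := \sum_(1 <= i < n.+1) w i.

Definition weight (R : realType) (sg : nat -> R) (n : nat) : R :=
  \sum_(1 <= k < n.+1) sg k.

Definition centered (R : realType) (sg : nat -> R) (w : nat -> bool) (k : nat) : R :=
  (w k)%:R - sg k.

Section density.
Context (R : realType) (sg : nat -> R).
Hypothesis sg_ge0 : forall k, 0 <= sg k.
Hypothesis sg_le1 : forall k, sg k <= 1.
Hypothesis sg1_gt0 : 0 < sg 1%N.
Hypothesis sgS : forall k, (0 < k)%N -> sg k.+1 <= sg k.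
Hypothesis sg_cvg0 : sg n @[n --> \oo] --> 0.
Hypothesis weight_infty : (weight sg n)^-1 @[n --> \oo] --> 0.

Local Notation W := (weight sg).

Lemma weightS n : W n.+1 = W n + sg n.+1.
Proof. by rewrite /weight big_nat_recr. Qed.

Lemma weight_homo : {homo W : m n / (m <= n)%N >-> m <= n}.
Proof. by apply: homo_leq => [//|m n k|n]; [exact: le_trans|rewrite weightS lerDl]. Qed.

Lemma weight_ge0 n : 0 <= W n.
Proof. exact: sumr_ge0. Qed.

Lemma weight_gt0 n : (0 < n)%N -> 0 < W n.
Proof.
move=> n0; apply: lt_le_trans (weight_homo n0).
by rewrite /weight big_nat1.
Qed.

Lemma sg_homo m n : (0 < m <= n)%N -> sg n <= sg m.
Proof.
move=> /andP[m0]; elim: n => [|n IH]; first by rewrite leqn0 => /eqP->.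
rewrite leq_eqVlt => /predU1P[->//|]; rewrite ltnS => mn.
by apply: le_trans (IH mn); apply: sgS; lia.
Qed.

Lemma weight_lower n : n%:R * sg n <= W n.
Proof.
rewrite (_ : _ * _ = \sum_(1 <= k < n.+1) sg n); last first.
  by rewrite sumr_const_nat subSS subn0 mulr_natl.
rewrite big_nat_cond [leRHS]big_nat_cond.
by apply: ler_sum => k /andP[/andP[k1 kn] _]; apply: sg_homo; lia.
Qed.

Lemma weight_diff m n : (0 < m <= n)%N -> W n - W m <= (n - m)%:R * sg m.
Proof.
move=> /andP[m0 mn]; rewrite /weight (big_cat_nat (n := m.+1))//=.
rewrite addrAC subrr add0r (_ : _ * _ = \sum_(m.+1 <= k < n.+1) sg m); last first.
  by rewrite sumr_const_nat subSS mulr_natl.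
rewrite big_nat_cond [leRHS]big_nat_cond.
by apply: ler_sum => k /andP[/andP[k1 kn] _]; apply: sg_homo; lia.
Qed.

(** As [sg] decreases, W n - W m <= (n - m) sg m and m sg m <= W m, so W n / W m <= n / m. For
    consecutive p-th powers the latter is (1 + 1/(j+1))^p. *)
Lemma weight_ratio_cvg1 (p : nat) :
  W (j.+2 ^ p)%N / W (j.+1 ^ p)%N @[j --> \oo] --> (1 : R).
Proof.
have lim : (1 + (j.+1%:R^-1 : R)) ^+ p @[j --> \oo] --> (1 : R).
  have h : 1 + (j.+1%:R^-1 : R) @[j --> \oo] --> (1 + 0 : R).
    by apply: cvgD; [exact: cvg_cst | exact: cvg_harmonic].
  have := continuous_cvg _ (@exprn_continuous R p _) h; rewrite addr0 expr1n; exact.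
apply: squeeze_cvgr lim; last exact: cvg_cst.
apply: nearW => j; have j0 : (0 < j.+1 ^ p)%N by rewrite expn_gt0.
have jj : (j.+1 ^ p <= j.+2 ^ p)%N by case: (p) => // q; rewrite leq_exp2r.
have W0 := weight_gt0 j0.
rewrite ler_pdivlMr// mul1r weight_homo//= ler_pdivrMr//.
have a0 : 0 < (j.+1 ^ p)%:R :> R by rewrite ltr0n.
have h1 := weight_diff (n := (j.+2 ^ p)%N) (m := (j.+1 ^ p)%N) ltac:(by rewrite j0).
have h2 := weight_lower (j.+1 ^ p).
have E : (1 + j.+1%:R^-1) ^+ p = (j.+2 ^ p)%:R / (j.+1 ^ p)%:R :> R.
  rewrite -{1}(@divff _ (j.+1%:R : R)) ?pnatr_eq0// -[X in _ + X]mul1r -mulrDl natr1.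
  by rewrite expr_div_n !natrX.
rewrite E natrB// in h1 *.
have h3 : W (j.+2 ^ p)%N <= W (j.+1 ^ p)%N +
    ((j.+2 ^ p)%:R / (j.+1 ^ p)%:R - 1) * ((j.+1 ^ p)%:R * sg (j.+1 ^ p)%N).
  rewrite mulrA mulrBl mul1r divfK ?gt_eqF//; lra.
apply: (le_trans h3).
have h4 : 0 <= (j.+2 ^ p)%:R / (j.+1 ^ p)%:R - 1 :> R.
  by rewrite subr_ge0 ler_pdivlMr// mul1r ler_nat.
move: (ler_wpM2l h4 h2); rewrite [in leRHS]mulrBl mul1r => h5.
by rewrite -lerBrDl.
Qed.

Variable w : nat -> bool.

Lemma hitsS n : hits w n.+1 = (hits w n + w n.+1)%N.
Proof. by rewrite /hits big_nat_recr. Qed.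

Lemma hits_homo : {homo hits w : m n / (m <= n)%N}.
Proof. by apply: homo_leq => [//|m n k|n]; [exact: leq_trans|rewrite hitsS leq_addr]. Qed.

Lemma centered_le1 k : `|centered sg w k| <= 1.
Proof.
have h0 := sg_ge0 k; have h1 := sg_le1 k.
by rewrite /centered ler_norml; case: (w k) => /=; apply/andP; split; lra.
Qed.

(** Stated for any [e] of size [w + sg] because it serves twice: for the hits themselves and for the
    ergodic sums, where centered hits are multiplied by bounded factors. *)
Lemma centered_interpolation (p : nat) (e : nat -> R) : (0 < p)%N ->
  (forall k, `|e k| <= (w k)%:R + sg k) ->
  (hits w (j.+1 ^ p))%:R / W (j.+1 ^ p)%N @[j --> \oo] --> (1 : R) ->
  (\sum_(1 <= k < (j.+1 ^ p).+1) e k) / W (j.+1 ^ p)%N @[j --> \oo] --> 0 ->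
  (\sum_(1 <= k < n.+1) e k) / W n @[n --> \oo] --> 0.
Proof.
move=> p0 ew c1 e0.
apply: (@interpolation_cvg0 _ W (fun n => \sum_(1 <= k < n.+1) e k)
  (fun n => (hits w n)%:R) (fun j => (j.+1 ^ p)%N)) => //.
- by rewrite exp1n weight_gt0.
- exact: weight_homo.
- by move=> m n mn; rewrite ler_nat hits_homo.
- move=> m n mn; rewrite /weight /hits.
  have split_at (V : nmodType) (F : nat -> V) : \sum_(1 <= k < n.+1) F k =
      \sum_(1 <= k < m.+1) F k + \sum_(m.+1 <= k < n.+1) F k.
    exact: big_cat_nat.
  rewrite !split_at natrD addrAC subrr add0r.
  rewrite [X in _ <= X + _]addrAC subrr add0r [X in _ <= _ + X]addrAC subrr add0r.
  rewrite natr_sum -big_split/=; apply: le_trans (ler_norm_sum _ _ _) _.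
  by apply: ler_sum.
- by move=> j; rewrite ltn_exp2r.
- exact: weight_ratio_cvg1.
Qed.

Lemma hits_cvg1 (p : nat) : (0 < p)%N ->
  ((hits w (j.+1 ^ p))%:R - W (j.+1 ^ p)%N) / W (j.+1 ^ p)%N @[j --> \oo] --> 0 ->
  (hits w n)%:R / W n @[n --> \oo] --> (1 : R).
Proof.
move=> p0 h.
have E n : \sum_(1 <= k < n.+1) centered sg w k = (hits w n)%:R - W n.
  by rewrite sumrB -natr_sum.
have cvg1_of (u : nat -> nat) : (forall j, 0 < u j)%N ->
    ((hits w (u j))%:R - W (u j)) / W (u j) @[j --> \oo] --> 0 ->
    (hits w (u j))%:R / W (u j) @[j --> \oo] --> (1 : R).
  move=> u0 lim; apply: (cvgD_eq lim (cvg_cst (1 : R))); first by rewrite add0r.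
  by move=> j; rewrite mulrBl divff ?subrK// gt_eqF// weight_gt0.
have lim : ((hits w n)%:R - W n) / W n @[n --> \oo] --> 0.
  have h' : (\sum_(1 <= k < (j.+1 ^ p).+1) centered sg w k) / W (j.+1 ^ p)%N
    @[j --> \oo] --> 0 by under eq_fun do rewrite E.
  under eq_fun do rewrite -E.
  apply: (centered_interpolation p0 _ _ h').
  - by move=> k; rewrite (le_trans (ler_normB _ _))// normr_nat ger0_norm.
  - by apply: (cvg1_of (fun j => (j.+1 ^ p)%N)) => // j; rewrite expn_gt0.
(* [W 0] is 0, so the identity behind [cvg1_of] fails at 0; the shift by one skips this index. *)
rewrite -(cvg_shiftS (fun n => (hits w n)%:R / W n)).
apply: (cvg1_of S) => //.
by rewrite (cvg_shiftS (fun n => ((hits w n)%:R - W n) / W n)).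
Qed.

Hypothesis hits1 : (hits w n)%:R / W n @[n --> \oo] --> (1 : R).

(** Hits are the only times at which a slowly varying factor may jump. Their weighted number is
    o(W), since [hits w n] is of order W n and the weights tend to 0. *)
Lemma weighted_hits_cvg0 :
  (\sum_(1 <= k < n.+1) sg k * (w k)%:R) / W n @[n --> \oo] --> 0.
Proof.
apply/cvgr0Pnorm_le => e e0.
have e40 : 0 < e / 4 by rewrite divr_gt0.
have [n1 _ h1] : \forall n \near \oo, `|sg n| <= e / 4 by exact: cvgr0_norm_le.
have [n2 _ h2] : \forall n \near \oo, (hits w n)%:R / W n <= 2.
  by apply: (cvgr_le _ hits1); lra.
have [n3 _ h3] : \forall n \near \oo, `|(W n)^-1| <= e / 4 / n1.+1%:R.
  by apply: cvgr0_norm_le => //; rewrite divr_gt0.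
exists (maxn 1 (maxn n1 (maxn n2 n3))) => // n /= nn.
have W0 : 0 < W n by apply: weight_gt0; lia.
rewrite ger0_norm; last first.
  by rewrite divr_ge0 ?weight_ge0// sumr_ge0// => k _; rewrite mulr_ge0.
have le : \sum_(1 <= k < n.+1) sg k * (w k)%:R <= n1%:R + e / 4 * (hits w n)%:R.
  have : \sum_(1 <= k < n1.+1) sg k * (w k)%:R <= n1%:R.
    rewrite -[leRHS](_ : \sum_(1 <= k < n1.+1) 1 = _); last first.
      by rewrite sumr_const_nat subSS subn0.
    by apply: ler_sum => k _; rewrite -[leRHS]mul1r ler_pM//; case: (w k).
  have : \sum_(n1.+1 <= k < n.+1) sg k * (w k)%:R <= e / 4 * (hits w n)%:R.
    rewrite /hits [in leRHS](big_cat_nat (n := n1.+1))//=; last by lia.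
    rewrite natrD mulrDr.
    apply: (@le_trans _ _ (e / 4 * (\sum_(n1.+1 <= i < n.+1) w i)%:R)); last first.
      by rewrite lerDr mulr_ge0// ltW.
    rewrite natr_sum mulr_sumr big_nat_cond [leRHS]big_nat_cond.
    apply: ler_sum => k /andP[/andP[k1 k2] _]; apply: ler_wpM2r => //.
    by apply: le_trans (ler_norm _) _; apply: h1 => /=; lia.
  move=> le1 le2; rewrite (big_cat_nat (n := n1.+1) (p := n.+1))//=; last by lia.
  exact: lerD.
apply: (@le_trans _ _ ((n1%:R + e / 4 * (hits w n)%:R) / W n)).
  by rewrite ler_pM2r ?invr_gt0.
rewrite mulrDl -mulrA.
have a1 := h2 n ltac:(rewrite /=; lia).
have a2 := h3 n ltac:(rewrite /=; lia).
rewrite ger0_norm ?invr_ge0 ?weight_ge0// in a2.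
have a3 : n1%:R / W n <= e / 4.
  apply: (@le_trans _ _ (n1%:R * (e / 4 / n1.+1%:R))).
    by rewrite ler_wpM2l.
  rewrite mulrCA -[leRHS]mulr1 ler_wpM2l ?(ltW e40)// ler_pdivrMr// mul1r ler_nat//.
have := ler_wpM2l (ltW e40) a1; lra.
Qed.

Section slowly_varying.
Variables (a : nat -> R) (Ka : R).
Hypothesis a_le : forall k, `|a k| <= Ka.
Hypothesis a_slow : forall k, ~~ w k.+1 -> a k.+1 = a k.

(** Summation by parts moves the difference from [b] to the product of [sg] and [a]. The variation
    of [sg] telescopes; that of [a] comes from hits only, with jumps of at most 2 Ka. *)
Lemma coboundary_sum_le (b : nat -> R) (Kb : R) n : (forall k, `|b k| <= Kb) ->
  `|\sum_(1 <= k < n.+1) sg k * (a k * (b k - b k.+1))| <=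
  2 * (Ka * Kb) * (1 + \sum_(1 <= k < n.+1) sg k * (w k)%:R).
Proof.
move=> b_le.
have Ka0 : 0 <= Ka := le_trans (normr_ge0 _) (a_le 0).
have Kb0 : 0 <= Kb := le_trans (normr_ge0 _) (b_le 0).
have K0 : 0 <= Ka * Kb by exact: mulr_ge0.
case: n => [|n]; first by rewrite !big_geq// normr0 addr0 mulr1 mulr_ge0.
have ab i j : `|a i * b j| <= Ka * Kb by rewrite normrM ler_pM.
(* The pending boundary term is carried along. On the right, [2 * sg 1 - sg m.+1] is the first term
   plus the total decrease of [sg]; it leaves exactly [sg m.+1] to pay for the pending term at the
   end. *)
have step m : `|\sum_(1 <= k < m.+2) sg k * (a k * (b k - b k.+1)) +
      sg m.+1 * (a m.+1 * b m.+2)| <=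
    Ka * Kb * (2 * sg 1 - sg m.+1 + 2 * \sum_(1 <= k < m.+2) sg k * (w k)%:R).
  elim: m => [|m IH].
    rewrite !big_nat1.
    have -> : sg 1 * (a 1%N * (b 1%N - b 2)) + sg 1 * (a 1%N * b 2) =
      sg 1 * (a 1%N * b 1%N) by ring.
    rewrite normrM ger0_norm// mulrC ler_pM//.
    by have := sg_ge0 1; case: (w 1) => /=; lra.
  rewrite [in leLHS]big_nat_recr// [in leRHS]big_nat_recr//=.
  set S1 := \sum_(1 <= k < m.+2) _ in IH *; set S2 := \sum_(1 <= k < m.+2) _ in IH *.
  rewrite (_ : _ + _ + _ = (S1 + sg m.+1 * (a m.+1 * b m.+2)) +
      (sg m.+2 * ((a m.+2 - a m.+1) * b m.+2) -
       (sg m.+1 - sg m.+2) * (a m.+1 * b m.+2))); last by ring.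
  apply: le_trans (ler_normD _ _) _.
  have h1 : `|sg m.+2 * ((a m.+2 - a m.+1) * b m.+2)| <=
      Ka * Kb * (2 * (sg m.+2 * (w m.+2)%:R)).
    rewrite normrM ger0_norm//.
    case: (boolP (w m.+2)) => [_|/a_slow ->]; last first.
      by rewrite subrr mul0r normr0 mulr0 mulr_ge0 ?mulr_ge0.
    rewrite (_ : Ka * Kb * _ = sg m.+2 * (Ka * Kb + Ka * Kb)); last by rewrite /=; ring.
    by rewrite ler_wpM2l// mulrBl (le_trans (ler_normB _ _))// lerD.
  have h2 : `|(sg m.+1 - sg m.+2) * (a m.+1 * b m.+2)| <=
      Ka * Kb * (sg m.+1 - sg m.+2).
    have h : 0 <= sg m.+1 - sg m.+2 by rewrite subr_ge0 sgS.
    by rewrite normrM ger0_norm// mulrC ler_wpM2r.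
  have := ler_normB (sg m.+2 * ((a m.+2 - a m.+1) * b m.+2))
    ((sg m.+1 - sg m.+2) * (a m.+1 * b m.+2)).
  move: IH h1 h2; lra.
have := step n.
set S1 := \sum_(1 <= k < n.+2) _; set S2 := \sum_(1 <= k < n.+2) _.
have h3 : `|sg n.+1 * (a n.+1 * b n.+2)| <= Ka * Kb * sg n.+1.
  by rewrite normrM ger0_norm// mulrC ler_wpM2r.
have := ler_normB (S1 + sg n.+1 * (a n.+1 * b n.+2)) (sg n.+1 * (a n.+1 * b n.+2)).
rewrite addrK.
have h4 := ler_wpM2l K0 (sg_le1 1%N).
move: h3 h4; lra.
Qed.

Lemma coboundary_avg_cvg0 (b : nat -> R) (Kb : R) (r : nat) :
  (forall k, `|b k| <= Kb) ->
  (\sum_(1 <= k < n.+1) sg k * (a k * (b k - b (k + r)%N))) / W n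
    @[n --> \oo] --> 0.
Proof.
move=> b_le; elim: r => [|r IH].
  have -> : (fun n => (\sum_(1 <= k < n.+1) sg k * (a k * (b k - b (k + 0)%N))) / W n)
      = fun=> 0.
    apply/funext => n; rewrite big1 ?mul0r// => k _.
    by rewrite addn0 subrr !mulr0.
  exact: cvg_cst.
have one : (\sum_(1 <= k < n.+1) sg k * (a k * (b (k + r)%N - b (k + r.+1)%N))) / W n
    @[n --> \oo] --> 0.
  have bound : 2 * (Ka * Kb) * ((W n)^-1 +
      (\sum_(1 <= k < n.+1) sg k * (w k)%:R) / W n) @[n --> \oo] --> 0.
    apply: (cvgZ_eq (k := 2 * (Ka * Kb)) (a := 0)) => //; last by rewrite mulr0.
    by apply: (cvgD_eq weight_infty weighted_hits_cvg0) => //; rewrite addr0.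
  apply/norm_cvg0P; apply: squeeze_cvgr bound; last exact: cvg_cst.
  apply: nearW => n; rewrite normr_ge0/= normrM normfV (ger0_norm (weight_ge0 n)).
  have := @coboundary_sum_le (fun k => b (k + r)%N) Kb n (fun k => b_le _).
  have : 0 <= (W n)^-1 by rewrite invr_ge0 weight_ge0.
  under eq_bigr do rewrite addnS.
  move=> W0 /(ler_wpM2r W0); under [in X in X -> _]eq_bigr do rewrite addSn.
  by move=> h; apply: (le_trans h); rewrite le_eqVlt; apply/orP; left; apply/eqP; ring.
apply: (cvgD_eq IH one); first by rewrite addr0.
move=> n; rewrite -mulrDl -big_split/=; congr (_ / _).
by apply: eq_bigr => k _; ring.
Qed.

(** Shifting [b] costs nothing in the limit, so [b] may be replaced by its window means. The
    unweighted means of their moduli tend to [G h], and [ler_sum_decreasing_weight] carries this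
    smallness over to the weights [sg]. *)
Lemma slow_avg_cvg0 (b : nat -> R) (Kb : R) (G : nat -> R) :
  (forall k, `|b k| <= Kb) ->
  (forall h, (\sum_(1 <= k < n.+1)
      `|h.+1%:R^-1 * \sum_(0 <= r < h.+1) b (k + r)%N|) / n%:R
    @[n --> \oo] --> G h) ->
  (forall e, 0 < e -> exists h, G h <= e) ->
  (\sum_(1 <= k < n.+1) sg k * (a k * b k)) / W n @[n --> \oo] --> 0.
Proof.
move=> b_le cvgG infG.
have Ka0 : 0 <= Ka := le_trans (normr_ge0 _) (a_le 0).
have Kb0 : 0 <= Kb := le_trans (normr_ge0 _) (b_le 0).
apply/cvgr0Pnorm_le => e e0.
pose eps := e / (8 * (Ka + 1)).
have eps0 : 0 < eps by rewrite divr_gt0// mulr_gt0// ltr_wpDl.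
have Keps : Ka * eps <= e / 8.
  rewrite (_ : Ka * eps = e / 8 * (Ka / (Ka + 1))); last first.
    by rewrite /eps; field; rewrite gt_eqF ?ltr_wpDl.
  rewrite ler_piMr ?divr_ge0 ?(ltW e0)// ler_pdivrMr ?ltr_wpDl//.
  by rewrite mul1r lerDl.
have [h Gh] := infG _ eps0.
pose bh k := h.+1%:R^-1 * \sum_(0 <= r < h.+1) b (k + r)%N.
have bh_le k : `|bh k| <= Kb.
  rewrite normrM normfV normr_nat ler_pdivrMl//.
  apply: le_trans (ler_norm_sum _ _ _) _.
  have -> : h.+1%:R * Kb = \sum_(0 <= r < h.+1) Kb.
    by rewrite sumr_const_nat subn0 mulr_natl.
  exact: ler_sum.
have diff : (\sum_(1 <= k < n.+1) sg k * (a k * (b k - bh k))) / W n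
    @[n --> \oo] --> 0.
  pose Fr r n := (\sum_(1 <= k < n.+1) sg k * (a k * (b k - b (k + r)%N))) / W n.
  have lim m : \sum_(0 <= r < m) Fr r n @[n --> \oo] --> (0 : R).
    elim: m => [|m IHm].
      by under eq_fun do rewrite big_geq//; exact: cvg_cst.
    apply: (cvgD_eq IHm (coboundary_avg_cvg0 m b_le)); first by rewrite addr0.
    by move=> n; rewrite big_nat_recr.
  apply: (cvgZ_eq (k := h.+1%:R^-1) (lim h.+1)); first by rewrite mulr0.
  move=> n; rewrite /Fr -mulr_suml mulrA; congr (_ / _).
  rewrite exchange_big_nat/= mulr_sumr; apply: eq_bigr => k _.
  rewrite -!mulr_sumr sumrB sumr_const_nat subn0 -[b k *+ _]mulr_natl.
  by rewrite /bh; field.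
have [n1 _ h1] : \forall n \near \oo,
    `|(\sum_(1 <= k < n.+1) sg k * (a k * (b k - bh k))) / W n| <= e / 4.
  by apply: cvgr0_norm_le => //; rewrite divr_gt0.
have [n2 _ h2] : \forall n \near \oo,
    (\sum_(1 <= k < n.+1) `|bh k|) / n%:R <= eps + eps.
  by apply: (cvgr_le _ (cvgG h)); rewrite (le_lt_trans Gh)// ltrDl.
have [n3 _ h3] : \forall n \near \oo,
    `|(W n)^-1| <= eps / (n2.+1%:R * (Kb + 1)).
  by apply: cvgr0_norm_le => //; rewrite divr_gt0// mulr_gt0// ltr_wpDl.
exists (maxn 1 (maxn n1 n3)) => // n /= nn.
have W0 : 0 < W n by apply: weight_gt0; lia.
have main : \sum_(1 <= k < n.+1) sg k * `|bh k| <=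
    (eps + eps) * W n + n2%:R * Kb.
  (* All partial sums must be dominated, but the means of |bh| are small only from [n2] on. The lump
     at index 1 covers the earlier ones and is negligible against W. *)
  pose v k := (eps + eps) + (if k == 1%N then n2%:R * Kb else 0).
  have sumv m : (0 < m)%N -> forall F : nat -> R,
      \sum_(1 <= k < m.+1) F k * v k =
      (eps + eps) * \sum_(1 <= k < m.+1) F k + F 1%N * (n2%:R * Kb).
    move=> m0 F; under eq_bigr do rewrite /v mulrDr.
    rewrite big_split/= -mulr_suml mulrC; congr (_ + _).
    rewrite big_ltn//= big_nat_cond big1 ?addr0// => k /andP[/andP[k1 _] _].
    by rewrite (_ : (k == 1)%N = false) ?mulr0//; apply/negbTE; lia.
  apply: (@le_trans _ _ (\sum_(1 <= k < n.+1) sg k * v k)).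
    apply: ler_sum_decreasing_weight => //.
    case=> [|m]; first by rewrite !big_geq.
    have := sumv m.+1 isT (fun=> 1); under eq_bigr do rewrite mul1r.
    move=> ->; rewrite mul1r sumr_const_nat subSS subn0.
    have [mn|nm] := leqP n2 m.+1.
      have := h2 m.+1 mn; rewrite ler_pdivrMr// => le.
      by apply: (le_trans le); rewrite lerDl mulr_ge0.
    apply: (@le_trans _ _ (\sum_(1 <= k < m.+2) Kb)); first exact: ler_sum.
    rewrite sumr_const_nat subSS subn0 -[Kb *+ _]mulr_natl.
    apply: (@le_trans _ _ (n2%:R * Kb)); first by rewrite ler_wpM2r// ler_nat ltnW.
    by rewrite lerDr mulr_ge0// addr_ge0// ltW.
  rewrite sumv; last by lia.
  by rewrite lerD2l// ler_piMl// mulr_ge0.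
have a3 : (n2%:R * Kb) / W n <= eps.
  have := h3 n ltac:(rewrite /=; lia).
  rewrite ger0_norm ?invr_ge0 ?weight_ge0// => le.
  apply: (@le_trans _ _ ((n2%:R * Kb) * (eps / (n2.+1%:R * (Kb + 1))))).
    by rewrite ler_wpM2l// mulr_ge0.
  rewrite mulrCA ler_piMr ?(ltW eps0)// ler_pdivrMr ?mul1r; last first.
    by rewrite mulr_gt0// ltr_wpDl.
  by rewrite ler_pM// ?ler_nat// lerDl.
have -> : \sum_(1 <= k < n.+1) sg k * (a k * b k) =
    \sum_(1 <= k < n.+1) sg k * (a k * (b k - bh k)) +
    \sum_(1 <= k < n.+1) sg k * (a k * bh k).
  by rewrite -big_split; apply: eq_bigr => k _ /=; ring.
rewrite mulrDl; apply: le_trans (ler_normD _ _) _.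
have b1 := h1 n ltac:(rewrite /=; lia).
have b2 : `|(\sum_(1 <= k < n.+1) sg k * (a k * bh k)) / W n| <=
    Ka * ((\sum_(1 <= k < n.+1) sg k * `|bh k|) / W n).
  rewrite normrM normfV (gtr0_norm W0) mulrA ler_pM2r ?invr_gt0//.
  apply: le_trans (ler_norm_sum _ _ _) _; rewrite mulr_sumr; apply: ler_sum => k _.
  by rewrite !normrM (ger0_norm (sg_ge0 k)) mulrCA ler_wpM2r// mulr_ge0.
have b3 : (\sum_(1 <= k < n.+1) sg k * `|bh k|) / W n <= eps + eps + eps.
  rewrite ler_pdivrMr// mulrDl; apply: (le_trans main); rewrite lerD2l.
  by rewrite -ler_pdivrMr.
have := ler_wpM2l Ka0 b3.
move: b1 b2 Keps; rewrite !mulrDr; lra.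
Qed.

End slowly_varying.

End density.

(** * Pointwise convergence along a good sequence *)

(** Indices are shifted by one because [vdc_bound] sums from 0. For p = 14c + 2 the last two
    arguments are, up to a bounded power of j, the optimal [l1] = (B_2 N)^(1/2) and [l2] = (N /
    (M_1^2 M_2))^(1/2). *)
Definition vdc_term (R : realType) (sg : nat -> R) (w : nat -> bool) (p c j : nat) : R :=
  vdc_bound (fun k => centered sg w k.+1) (fun k => hits w k.+1) (j ^ p)
    (j ^ c) (j ^ (p - c)) (j ^ (4 * c)) (j ^ (p - 4 * c))
    (j ^ (p - 2 * c))%:R (j ^ (4 * c))%:R.

Section good_sequence.
Context (R : realType) (sg : nat -> R) (w : nat -> bool) (p c : nat) (C : R).
Hypothesis sg_ge0 : forall k, 0 <= sg k.
Hypothesis sg_le1 : forall k, sg k <= 1.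
Hypothesis sg1_gt0 : 0 < sg 1%N.
Hypothesis sgS : forall k, (0 < k)%N -> sg k.+1 <= sg k.
Hypothesis sg_cvg0 : sg n @[n --> \oo] --> 0.
Hypothesis weight_infty : (weight sg n)^-1 @[n --> \oo] --> 0.
Hypothesis p_gt0 : (0 < p)%N.
Hypothesis cp : (4 * c <= p)%N.
Hypothesis hits1 : (hits w n)%:R / weight sg n @[n --> \oo] --> (1 : R).
Hypothesis vdc_summable : forall J,
  \sum_(0 <= j < J) vdc_term sg w p c j.+1 / weight sg (j.+1 ^ p)%N ^+ 2 <= C.

Local Notation W := (weight sg).

Section system.
Context d (X : measurableType d) (mu : probability X R).
Variables T1 T2 : X -> X.
Hypothesis pT1 : measure_preserving mu T1.
Hypothesis pT2 : measure_preserving mu T2.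
Hypothesis TC : forall x, T1 (T2 x) = T2 (T1 x).

Lemma centered_avg_cvg0_unit (f1 f2 : X -> R) :
  measurable_fun [set: X] f1 -> measurable_fun [set: X] f2 ->
  (forall x, `|f1 x| <= 1) -> (forall x, `|f2 x| <= 1) ->
  \forall x \ae mu, (\sum_(1 <= k < n.+1) centered sg w k *
    (f1 (iter (hits w k) T1 x) * f2 (iter k T2 x))) / W n @[n --> \oo] --> 0.
Proof.
move=> mf1 mf2 f1_1 f2_1.
pose e x k := centered sg w k * (f1 (iter (hits w k) T1 x) * f2 (iter k T2 x)).
have mT2 : measurable_fun [set: X] T2 by case: pT2.
pose F j x := ((\sum_(1 <= k < (j.+1 ^ p).+1) e x k) / W (j.+1 ^ p)%N) ^+ 2.
have be k : bounded_measurable (fun x => e x k).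
  apply: bounded_measurableZ; apply: bounded_measurableM.
  - apply: (bounded_measurable_comp (T := iter (hits w k) T1)); last by split=> //; exists 1.
    by case: (measure_preserving_iter (hits w k) pT1).
  - apply: (bounded_measurable_comp (T := iter k T2)); last by split=> //; exists 1.
    by case: (measure_preserving_iter k pT2).
have bsum j : bounded_measurable (fun x => \sum_(1 <= k < (j.+1 ^ p).+1) e x k).
  exact: bounded_measurable_sum.
have bF j : bounded_measurable (F j).
  apply: bounded_measurableX; apply: bounded_measurableM => //.
  exact: bounded_measurable_cst.
have intF j : \int[mu]_x F j x <= vdc_term sg w p c j.+1 / W (j.+1 ^ p)%N ^+ 2.
  have E x : F j x = (W (j.+1 ^ p)%N ^+ 2)^-1 *
      (\sum_(1 <= k < (j.+1 ^ p).+1) e x k) ^+ 2.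
    by rewrite /F exprMn exprVn mulrC.
  under eq_Rintegral do rewrite E.
  rewrite RintegralZ_bounded; last exact: bounded_measurableX.
  rewrite mulrC ler_wpM2r ?invr_ge0 ?sqr_ge0//.
  under eq_Rintegral do rewrite big_add1/=.
  have j0 : (0 < j.+1)%N by [].
  (* The sum now starts at 0: the missing step of [T2] goes into [f2], and the one for [T1] is
     already in [hits w k.+1]. *)
  apply: (@van_der_corput_bound _ _ _ mu T1 T2 f1 (f2 \o T2)) => //.
  - exact: measurableT_comp.
  - by move=> x; exact: f2_1.
  - by move=> k; exact: centered_le1.
  - by move=> k; rewrite [hits w k.+2]hitsS; case: (w _) => /=; lia.
  - by rewrite -expnD subnKC//; lia.
  - by rewrite -expnD subnKC.
have ae : \forall x \ae mu, exists C', forall J, \sum_(0 <= j < J) F j x <= C'.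
  apply: (ae_bounded_series (C := C)) => //; first by move=> j x; exact: sqr_ge0.
  move=> J; rewrite Rintegral_sum//; apply: le_trans (vdc_summable J).
  exact: ler_sum.
apply: filterS ae => x [C' hC'].
apply: (centered_interpolation sg_ge0 sg1_gt0 sgS p_gt0 (e := e x)).
- move=> k; rewrite /e normrM -[leRHS]mulr1 ler_pM//.
    by rewrite (le_trans (ler_normB _ _))// normr_nat ger0_norm.
  by rewrite normrM mulr_ile1.
- apply: (cvg_subseq _ hits1) => j; apply: ltnW.
  by case: (p) p_gt0 => // q _; rewrite expnS leq_pmulr// expn_gt0.
- by apply: sqr_cvg0; exact: ge0_bounded_series_cvg0 (fun j => sqr_ge0 _) hC'.
Qed.

Lemma centered_avg_cvg0 (f1 f2 : X -> R) :
  bounded_measurable f1 -> bounded_measurable f2 ->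
  \forall x \ae mu, (\sum_(1 <= k < n.+1) centered sg w k *
    (f1 (iter (hits w k) T1 x) * f2 (iter k T2 x))) / W n @[n --> \oo] --> 0.
Proof.
move=> [mf1 [K1 h1]] [mf2 [K2 h2]].
have scale (f : X -> R) (K : R) : (forall x : X, `|f x| <= K) ->
    forall x, `|(`|K| + 1)^-1 * f x| <= 1.
  move=> fK x; have K0 : 0 < `|K| + 1 by rewrite ltr_wpDl.
  rewrite normrM normfV (gtr0_norm K0) ler_pdivrMl// mulr1.
  by rewrite (le_trans (fK x))// (le_trans (ler_norm _))// lerDl.
have mscale (f : X -> R) (K : R) : measurable_fun [set: X] f ->
    measurable_fun [set: X] (fun x => (`|K| + 1)^-1 * f x : R).
  by move=> mf; apply: measurable_funM => //; exact: measurable_cst.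
have := centered_avg_cvg0_unit (mscale _ K1 mf1) (mscale _ K2 mf2)
  (scale _ _ h1) (scale _ _ h2).
apply: filterS => x lim.
apply: (cvgZ_eq (k := (`|K1| + 1) * (`|K2| + 1)) lim); first by rewrite mulr0.
move=> n; rewrite mulrA; congr (_ / _); rewrite mulr_sumr; apply: eq_bigr => k _.
by field; rewrite !gt_eqF ?ltr_wpDl.
Qed.

Local Notation intr f := (mu.-integrable [set: X] (EFin \o f)).

(** By [birkhoff], the averages of [window f h] along [T2]-orbits tend to [window_cond_exp f h],
    which becomes the [G h] of [slow_avg_cvg0]. *)
Let window (f : X -> R) (h : nat) (x : X) : R :=
  `|h.+1%:R^-1 * birkhoff_sum T2 f h.+1 x|.

Let window_cond_exp (f : X -> R) (h : nat) : X -> R :=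
  cond_exp mu (invariant_sets mu T2) (window f h).

Let bounded_measurable_window f h : bounded_measurable f ->
  bounded_measurable (window f h).
Proof.
move=> bf; apply: bounded_measurable_norm; apply: bounded_measurableZ.
apply: bounded_measurable_sum => k _.
by apply: bounded_measurable_comp bf; case: (measure_preserving_iter k pT2).
Qed.

(** The integrals of the windows tend to 0 by dominated convergence. By Markov's inequality, applied
    to the conditional expectations, the points where all of these are at least 1/(m+1) form a null
    set. Only one good h per point and e is sought, not a limit in h. *)
Let window_cond_exp_small f : bounded_measurable f ->
  (\forall x \ae mu, n%:R^-1 * birkhoff_sum T2 f n x @[n --> \oo] --> 0) ->
  \forall x \ae mu, forall e, 0 < e -> exists h, window_cond_exp f h x <= e.
Proof.
move=> bf f0; have bw h := bounded_measurable_window h bf.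
have [mf [K fK]] := bf.
have wK h x : `|window f h x| <= K.
  rewrite normr_id normrM normfV normr_nat ler_pdivrMl//.
  apply: le_trans (ler_norm_sum _ _ _) _.
  have -> : h.+1%:R * K = \sum_(0 <= r < h.+1) K.
    by rewrite sumr_const_nat subn0 mulr_natl.
  exact: ler_sum.
have int0 : \int[mu]_x window f h x @[h --> \oo] --> 0.
  rewrite -(Rintegral_prob_cst mu 0).
  apply: (@Rintegral_dominated_cvg _ _ _ mu _ _ (fun=> K)) => //.
  - by move=> h; case: (bw h).
  - apply: filterS f0 => x lim; rewrite -[X in _ --> X](@normr0 R R).
    apply: cvg_norm.
    by rewrite (cvg_shiftS (fun n => n%:R^-1 * birkhoff_sum T2 f n x)).
  - exact: (bounded_measurable_integrable mu (bounded_measurable_cst X K)).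
pose A (m h : nat) := [set x | m.+1%:R^-1 <= window_cond_exp f h x].
have small m : mu.-negligible (\bigcap_h A m h).
  have AE h : A m h = (window_cond_exp f h) @^-1` `[m.+1%:R^-1, +oo[%classic.
    by apply/seteqP; split => x /=; rewrite in_itv/= andbT.
  have P h := cond_exp_invariantP pT2 (bounded_measurable_integrable mu (bw h)).
  have IA h : invariant_sets mu T2 (A m h).
    by rewrite AE; case: (P h) => + _ _; apply; exact: measurable_itv.
  have mA h : measurable (A m h) by case: (IA h).
  have muA h : fine (mu (A m h)) <= m.+1%:R * \int[mu]_x window f h x.
    rewrite -ler_pdivrMl//.
    have -> : m.+1%:R^-1 * fine (mu (A m h)) = \int[mu]_(x in A m h) m.+1%:R^-1.
      by rewrite Rintegral_cst.
    have [_ inth hA] := P h.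
    apply: (@le_trans _ _ (\int[mu]_(x in A m h) window_cond_exp f h x)).
      apply: le_Rintegral => //.
        apply: integrableS
          (bounded_measurable_integrable mu (bounded_measurable_cst X m.+1%:R^-1)) => //.
      exact: integrableS inth.
    rewrite hA// Rintegral_indic; apply: ler_Rintegral => //.
      apply: bounded_measurableM => //; split; first exact: measurable_indic.
      by exists 1 => x; rewrite indicE; case: (_ \in _); rewrite ?normr1 ?normr0.
    by move=> x; rewrite indicE; case: (_ \in _); rewrite ?mulr1 ?mulr0// normr_ge0.
  have mB : measurable (\bigcap_h A m h) by exact: bigcapT_measurable.
  exists (\bigcap_h A m h); split => //.
  apply/eqP; rewrite eq_le measure_ge0 andbT -[leLHS]fineK ?fin_num_measure// lee_fin.
  have lim : m.+1%:R * \int[mu]_x window f h x @[h --> \oo] --> 0.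
    by apply: (cvgZ_eq int0) => //; rewrite mulr0.
  apply: (cvgr_to_ge lim); apply: nearW => h; apply: le_trans (muA h).
  rewrite fine_le ?fin_num_measure//.
  by apply: le_measure; rewrite ?inE//; exact: bigcap_inf.
have [B [mB B0 hB]] : mu.-negligible (\bigcup_m \bigcap_h A m h).
  exact: negligible_bigcup.
exists B; split => // x /= nx; apply: hB; apply: contrapT => nB; apply: nx => e e0.
apply: contrapT => ne; apply: nB; exists (Num.truncn e^-1) => // h _ /=.
rewrite /A/= leNgt; apply/negP => lt; apply: ne; exists h; apply: (le_trans (ltW lt)).
by rewrite -[leRHS]invrK lef_pV2 ?posrE ?invr_gt0// ltW// truncnS_gt.
Qed.

Lemma weighted_avg_cvg0 (f1 f2 : X -> R) :
  bounded_measurable f1 -> bounded_measurable f2 ->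
  (\forall x \ae mu, n%:R^-1 * birkhoff_sum T2 f2 n x @[n --> \oo] --> 0) ->
  \forall x \ae mu, (\sum_(1 <= k < n.+1) sg k *
    (f1 (iter (hits w k) T1 x) * f2 (iter k T2 x))) / W n @[n --> \oo] --> 0.
Proof.
move=> bf1 bf2 f20; have bw h := bounded_measurable_window h bf2.
have [[_ [K1 h1]] [_ [K2 h2]]] := (bf1, bf2).
have aw := ae_foralln (fun h =>
  birkhoff pT2 (bounded_measurable_integrable mu (bw h))).
(* The weighted sums start at k = 1, so the orbit averages are taken from [T2 x]. *)
have := ae_comp pT2 (ae_and aw (window_cond_exp_small bf2 f20)).
apply: filterS => x [lim small].
pose G h := window_cond_exp f2 h (T2 x).
have slow k : ~~ w k.+1 -> f1 (iter (hits w k.+1) T1 x) = f1 (iter (hits w k) T1 x).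
  by move=> wk; rewrite hitsS (negbTE wk) addn0.
apply: (@slow_avg_cvg0 _ sg sg_ge0 sg_le1 sg1_gt0 sgS sg_cvg0 weight_infty w hits1
  (fun k => f1 (iter (hits w k) T1 x)) K1 (fun k => h1 _) slow
  (fun k => f2 (iter k T2 x)) K2 G (fun k => h2 _) _ small).
move=> h; have := lim h; apply: cvg_trans; apply: near_eq_cvg; apply: nearW => n.
rewrite mulrC; congr (_ / _); rewrite big_add1/= /birkhoff_sum.
apply: eq_bigr => k _; rewrite /window -iterSr; congr (`|_ * _|).
by apply: eq_bigr => r _; rewrite -iterD addnC.
Qed.

Variable b : nat -> nat.
Hypothesis hits_b : forall n, hits w (b n) = n.
Hypothesis b_hits : forall k, w k.+1 -> b (hits w k.+1) = k.+1.

Let sum_hits (F : nat -> nat -> R) (n : nat) :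
  \sum_(1 <= k < n.+1) (w k)%:R * F (hits w k) k =
  \sum_(1 <= i < (hits w n).+1) F i (b i).
Proof.
elim: n => [|n IH]; first by rewrite /hits !big_geq.
rewrite big_nat_recr//= IH hitsS; case: (boolP (w n.+1)) => wn; last first.
  by rewrite mul0r addr0 addn0.
rewrite /= addn1 mul1r [RHS]big_nat_recr//=; congr (_ + F _ _).
by rewrite -[(hits w n).+1]addn1 -(b_hits wn) hitsS wn.
Qed.

Lemma hits_le n : (hits w n <= n)%N.
Proof.
elim: n => [|n IH]; first by rewrite /hits big_geq.
by rewrite hitsS; case: (w _) => /=; lia.
Qed.

Lemma hitting_avg_cvg0 (f1 f2 : X -> R) :
  bounded_measurable f1 -> bounded_measurable f2 ->
  (\forall x \ae mu, n%:R^-1 * birkhoff_sum T2 f2 n x @[n --> \oo] --> 0) ->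
  \forall x \ae mu, N%:R^-1 * \sum_(1 <= n < N.+1)
    f1 (iter n T1 x) * f2 (iter (b n) T2 x) @[N --> \oo] --> 0.
Proof.
move=> bf1 bf2 f20.
have := ae_and (centered_avg_cvg0 bf1 bf2) (weighted_avg_cvg0 bf1 bf2 f20).
apply: filterS => x [lim1 lim2].
have b_ge N : (N <= b N)%N by rewrite -{1}(hits_b N) hits_le.
pose F i k := f1 (iter i T1 x) * f2 (iter k T2 x).
have lim : (\sum_(1 <= k < n.+1) (w k)%:R * F (hits w k) k) / W n @[n --> \oo] --> 0.
  apply: (cvgD_eq lim1 lim2); first by rewrite addr0.
  move=> n; rewrite -mulrDl -big_split/=; congr (_ / _); apply: eq_bigr => k _.
  by rewrite -mulrDl /centered subrK.
have inv : ((hits w n)%:R / W n)^-1 @[n --> \oo] --> (1^-1 : R).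
  by apply: cvgV => //; exact: oner_neq0.
(* At n = b N the number of hits is exactly N; there W cancels and the mean over the first N hits
   remains. *)
have limM : (\sum_(1 <= k < n.+1) (w k)%:R * F (hits w k) k) / W n *
    ((hits w n)%:R / W n)^-1 @[n --> \oo] --> (0 * 1^-1 : R) by exact: cvgM lim inv.
have := cvg_subseq b_ge limM; rewrite mul0r.
apply: cvg_trans; apply: near_eq_cvg; exists 1%N => // N /= N1.
rewrite /= sum_hits hits_b.
have W0 : W (b N) != 0.
  by rewrite gt_eqF// weight_gt0//; apply: leq_trans (b_ge N).
have N0 : N%:R != 0 :> R by rewrite pnatr_eq0; lia.
by rewrite /F invfM invrK mulrACA mulVf// mulr1 mulrC.
Qed.

Lemma hitting_avg_cvg_bounded (f1 f2 : X -> R) :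
  bounded_measurable f1 -> bounded_measurable f2 ->
  \forall x \ae mu, N%:R^-1 * \sum_(1 <= n < N.+1)
    f1 (iter n T1 x) * f2 (iter (b n) T2 x) @[N --> \oo] -->
    cond_exp mu (invariant_sets mu T1) f1 x * cond_exp mu (invariant_sets mu T2) f2 x.
Proof.
move=> bf1 bf2.
have int1 := bounded_measurable_integrable mu bf1.
have int2 := bounded_measurable_integrable mu bf2.
have [mf2 [K f2K]] := bf2.
set h1 := cond_exp _ _ f1; set h2 := cond_exp _ _ f2.
have [_ inth2 _] : is_cond_exp mu (invariant_sets mu T2) f2 h2.
  exact: cond_exp_invariantP.
have mh2 : measurable_fun [set: X] h2.
  exact/measurable_EFinP/(measurable_int _ inth2).
(* The chosen version [h2] is bounded by K only almost everywhere, as a limit of averages of [f2].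
   Its truncation is bounded everywhere and differs from it on a null set. *)
pose h2' x := Num.min K (Num.max (- K) (h2 x)).
have avg_le n x : `|n%:R^-1 * birkhoff_sum T2 f2 n x| <= `|K|.
  case: n => [|n]; first by rewrite invr0 mul0r normr0.
  rewrite normrM normfV normr_nat ler_pdivrMl//.
  apply: le_trans (ler_norm_sum _ _ _) _.
  have -> : n.+1%:R * `|K| = \sum_(0 <= r < n.+1) `|K|.
    by rewrite sumr_const_nat subn0 mulr_natl.
  by apply: ler_sum => k _; apply: le_trans (f2K _) (ler_norm K).
have K0 x : 0 <= K := le_trans (normr_ge0 _) (f2K x).
have h2E : \forall x \ae mu, h2' x = h2 x.
  apply: filterS (birkhoff pT2 int2) => x lim.
  have {}lim : `|n%:R^-1 * birkhoff_sum T2 f2 n x| @[n --> \oo] --> `|h2 x|.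
    exact: cvg_norm lim.
  have : `|h2 x| <= `|K| by apply: (cvgr_to_le lim); apply: nearW => n; exact: avg_le.
  rewrite (ger0_norm (K0 x)) ler_norml /h2' => /andP[a1 a2].
  by rewrite max_r// min_r.
have bh2' : bounded_measurable h2'.
  split.
    by apply: measurable_minr => //; exact: measurable_maxr.
  exists `|K| => x; rewrite (ger0_norm (K0 x)) ler_norml ge_min lexx/= le_min le_max lexx/=.
  by rewrite (le_trans _ (K0 x))// oppr_le0 (K0 x).
pose g2 x := f2 x - h2' x.
have bg2 : bounded_measurable g2 by exact: bounded_measurableB.
have inv2 := cond_exp_invariant pT2 int2.
have h2'T x : (forall k, h2 (iter k T2 x) = h2 x) -> forall k, h2' (iter k T2 x) = h2' x.
  by move=> hx k; rewrite /h2' hx.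
have g20 : \forall x \ae mu, n%:R^-1 * birkhoff_sum T2 g2 n x @[n --> \oo] --> 0.
  have := ae_and h2E (ae_and inv2 (birkhoff pT2 int2)).
  apply: filterS => x [h2x [hx lim]].
  have {}lim : n%:R^-1 * birkhoff_sum T2 f2 n x - h2 x @[n --> \oo] --> 0.
    by apply: (cvgD_eq lim (cvg_cst (- h2 x))) => //; rewrite subrr.
  apply: cvg_trans lim; apply: near_eq_cvg; exists 1%N => // n /= n1.
  have n0 : n%:R != 0 :> R by rewrite pnatr_eq0; lia.
  rewrite /birkhoff_sum /g2 sumrB mulrBr; congr (_ - _).
  under eq_bigr do rewrite h2'T// h2x.
  by rewrite sumr_const_nat subn0 -[h2 x *+ _]mulr_natl mulKf.
have B1 := ae_comp pT1 (birkhoff pT1 int1).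
have inv1 := cond_exp_invariant pT1 int1.
have := ae_and (ae_and h2E inv2) (ae_and (ae_and B1 inv1) (hitting_avg_cvg0 bf1 bg2 g20)).
apply: filterS => x [[h2x hx2] [[lim1 hx1] lim2]].
(* The sums start at 1, so [birkhoff] is used at [T1 x]; invariance of [h1] brings the limit back to
   x. *)
have {}lim1 : N%:R^-1 * \sum_(1 <= n < N.+1) f1 (iter n T1 x) @[N --> \oo] --> h1 x.
  rewrite /h1 -(hx1 1%N); apply: cvg_trans lim1; apply: near_eq_cvg; apply: nearW => N /=.
  by rewrite big_add1; congr (_ * _); apply: eq_bigr => k _; rewrite -iterSr.
have {}lim1 : h2 x * (N%:R^-1 * \sum_(1 <= n < N.+1) f1 (iter n T1 x))
    @[N --> \oo] --> h1 x * h2 x.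
  by apply: (cvgZ_eq lim1) => //; rewrite mulrC.
apply: (cvgD_eq lim1 lim2); first by rewrite addr0.
move=> N; rewrite mulrCA -mulrDr; congr (_ * _).
rewrite mulr_sumr -big_split/=; apply: eq_bigr => k _.
by rewrite /g2 h2'T// h2x; ring.
Qed.

End system.
End good_sequence.

(** * Mixing of the hitting sequence *)

Lemma total_variation_nonincreasing01 (R : realType) (f : R -> R) :
  (forall x, 0 <= f x <= 1) -> {in `[0, 1] &, nonincreasing_fun f} ->
  (total_variation 0 1 f <= 1)%E.
Proof.
move=> f01 ndf; rewrite -total_variationN nondecreasing_total_variation//=.
  by rewrite lee_fin opprK addrC; move: (f01 0) (f01 1); lra.
by move=> x y x0 y0 xy /=; rewrite lerN2; exact: ndf.
Qed.

(** One for the supremum and one for each of two monotone indicators. The bound is common to all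
    intervals, so the error in the decay depends on n through [rho] only. *)
Lemma BVnorm_interval (R : realType) (i : interval R) :
  (BVnorm (fun t : unitI R => (unitI_val t \in i)%:R) <= 3%:E)%E.
Proof.
rewrite /BVnorm (_ : 3 = 1 + 2)// EFinD; apply: leeD.
  apply: ge_ereal_sup => _ [t _ <-]; rewrite lee_fin.
  by case: (_ \in _); rewrite ?normr1 ?normr0.
case: i => l r.
(* The indicator of an interval is a difference of two nonincreasing
   indicators. *)
pose u (x : R) : unitI R := insubd (unitI0 R) x.
pose al (x : R) : R := ((BRight (unitI_val (u x)) <= r)%O)%:R.
(* Keeping the right-end condition in [be] makes [al - be] the indicator even when the end points
   are in the wrong order. *)
pose be (x : R) : R :=
  ((BRight (unitI_val (u x)) <= r)%O && ~~ (l <= BLeft (unitI_val (u x)))%O)%:R.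
have uE x : x \in `[0, 1] -> unitI_val (u x) = x by move=> x01; exact: insubdK.
have b01 (b : bool) : 0 <= (b%:R : R) <= 1 by case: b; rewrite /= ?lexx ?ler01.
rewrite (_ : (fun x : R => _) = (al \+ (\- be))%R); last first.
  apply/funext => x; rewrite /al /be itv_boundlr /=.
  by case: (_ <= _)%O; case: (_ <= _)%O; rewrite /= ?subrr ?subr0.
rewrite (_ : 2 = 1 + 1)// EFinD.
apply: (le_trans (total_variation_le _ _ ler01)); rewrite total_variationN.
apply: leeD; apply: total_variation_nonincreasing01; try by move=> x; exact: b01.
- move=> x y x0 y0 xy; rewrite /al !uE// ler_nat.
  case: (boolP (BRight y <= r)%O) => //= yr.
  by rewrite (le_trans _ yr)// bnd_simp.
- move=> x y x0 y0 xy; rewrite /be !uE// ler_nat.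
  case: (boolP (BRight y <= r)%O) => //= yr.
  rewrite (le_trans _ yr) ?bnd_simp//=.
  case: (boolP (l <= BLeft x)%O) => //= lx; last by rewrite leq_b1.
  by rewrite (le_trans lx)// bnd_simp.
Qed.

(** Induction on the number of coordinates: splitting by the last one expresses [F] through
    indicators of measurable sets and functions of fewer coordinates, without a sigma-algebra on
    sequences. *)
Lemma bounded_measurable_coord d (T : measurableType d) (R : realType)
    (u : T -> nat -> bool) (n : nat) (F : (nat -> bool) -> R) :
  (forall k, measurable [set t | u t k]) ->
  (forall v v', (forall k, (k < n)%N -> v k = v' k) -> F v = F v') ->
  bounded_measurable (fun t => F (u t)).
Proof.
move=> mu; elim: n F => [|n IH] F depF.
  rewrite (_ : (fun t => _) = fun=> F (fun=> false)); first exact: bounded_measurable_cst.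
  by apply/funext => t; exact: depF.
pose set_n (b : bool) (v : nat -> bool) k := if k == n then b else v k.
have bset b : bounded_measurable (fun t => F (set_n b (u t))).
  apply: (IH (fun v => F (set_n b v))) => v v' vv'; apply: depF => k kn.
  rewrite /set_n.
  by case: (eqVneq k n) => // kn'; apply: vv'; lia.
have E : (fun t => F (u t)) = fun t =>
    \1_[set t | u t n] t * F (set_n true (u t)) +
    \1_(~` [set t | u t n]) t * F (set_n false (u t)).
  apply/funext => t; rewrite !indicE in_setC.
  case: (boolP (t \in [set t | u t n])) => [|/negP] h.
    rewrite mul1r mul0r addr0; apply: depF => k _; rewrite /set_n.
    by case: eqP => // ->; exact: (set_mem h).
  rewrite mul1r mul0r add0r; apply: depF => k _; rewrite /set_n.
  case: eqP => // ->; apply/negbTE/negP => un; apply: h; exact: mem_set.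
have b1 (A : set T) : measurable A -> bounded_measurable (\1_A : T -> R).
  move=> mA; split; first exact: measurable_indic.
  by exists 1 => t; rewrite indicE; case: (_ \in _); rewrite ?normr1 ?normr0.
rewrite E; apply: bounded_measurableD; apply: bounded_measurableM => //; apply: b1 => //.
exact: measurableC.
Qed.

Section mixing.
Context (R : realType) (nu : probability (unitI R) R) (S : unitI R -> unitI R).
Variables (rho : nat -> R) (I : nat -> interval R) (sg : nat -> R).
Variables (phi : nat -> nat) (C : R).
Hypothesis S_preserving : measure_preserving nu S.
Hypothesis rho_ge0 : forall m : nat, (0 < m)%N -> 0 <= rho m.
Hypothesis I_measure : forall n : nat, (0 < n)%N ->
  nu (@unitI_val R @^-1` [set` I n]) = (sg n)%:E.
Hypothesis phi_increasing : increasing_seq1 phi.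
Hypothesis rho_phi : forall n : nat, (0 < n)%N ->
  rho (phi n.+1 - phi n)%N <= C / n%:R.

Definition hit (y : unitI R) (k : nat) : bool :=
  unitI_val (iter (phi k) S y) \in I k.

Lemma measurable_unitI_interval (i : interval R) :
  measurable [set t : unitI R | unitI_val t \in i].
Proof. by exists [set` i]; [exact: measurable_itv | rewrite setTI]. Qed.

Lemma measurable_iter_interval n (i : interval R) :
  measurable [set y : unitI R | unitI_val (iter n S y) \in i].
Proof.
have [mS _] := measure_preserving_iter n S_preserving.
rewrite (_ : [set y | _] = [set: unitI R] `&`
  iter n S @^-1` [set t | unitI_val t \in i]); last by rewrite setTI.
by apply: mS => //; exact: measurable_unitI_interval.
Qed.

Definition interval_indic (n : nat) (t : unitI R) : R := (unitI_val t \in I n)%:R.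

Lemma interval_indicE n t :
  interval_indic n t = \1_[set t : unitI R | unitI_val t \in I n] t.
Proof.
rewrite indicE /interval_indic; congr (nat_of_bool _)%:R.
by apply/idP/idP => [h|/set_mem//]; exact: mem_set.
Qed.

Lemma bounded_measurable_interval_indic n : bounded_measurable (interval_indic n).
Proof.
split; last by exists 1 => t; rewrite normr_nat lern1 leq_b1.
rewrite (_ : interval_indic n = \1_[set t : unitI R | unitI_val t \in I n]).
  exact/measurable_indic/measurable_unitI_interval.
by apply/funext => t; exact: interval_indicE.
Qed.

Lemma expectation_hit n : (0 < n)%N -> \int[nu]_y (hit y n)%:R = sg n.
Proof.
move=> n0.
have mA := measurable_unitI_interval (I n).
transitivity (\int[nu]_y (interval_indic n (iter (phi n) S y))) => //.
rewrite (Rintegral_comp (measure_preserving_iter (phi n) S_preserving)); last first.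
  exact/bounded_measurable_integrable/bounded_measurable_interval_indic.
under eq_Rintegral do rewrite interval_indicE.
by rewrite /Rintegral integral_indic// setIT; move: (I_measure n0) => /= ->.
Qed.

(* A function of the hits at times after [n] factors through S^phi(n+1), so
   the decay of correlation applies at time phi(n+1) - phi(n). *)
Lemma mixing_hit n L (F : (nat -> bool) -> R) (C' : R) : (0 < n)%N -> 0 < C' ->
  (forall (m : nat) (f g : unitI R -> R), (0 < m)%N ->
      (BVnorm f < +oo)%E -> g \in Lfun nu 1%E ->
      (`| \int[nu]_t (f t * g (iter m S t))
          - (\int[nu]_t f t) * (\int[nu]_t g t) |%:E
       <= (C' * rho m)%:E * BVnorm f * 'N[nu]_1%E[EFin \o g])%E) ->
  (forall v v', (forall k, (n < k < L)%N -> v k = v' k) -> F v = F v') ->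
  (forall v, `|F v| <= 1) ->
  `|\int[nu]_y (centered sg (hit y) n * F (hit y))| <= 3 * C' * C / n%:R.
Proof.
move=> n0 C'0 decay depF F1.
have phi_mono k : (n < k)%N -> (phi n.+1 <= phi k)%N.
  rewrite leq_eqVlt => /predU1P[<-//|nk]; apply/ltnW/phi_increasing; lia.
have m0 : (0 < phi n.+1 - phi n)%N by rewrite subn_gt0; apply: phi_increasing; lia.
set m := (phi n.+1 - phi n)%N in m0.
(* The hits after n as seen from time phi(n+1); the test [n < k] makes the truncated subtraction
   exact. *)
pose v (t : unitI R) k := (n < k)%N && (unitI_val (iter (phi k - phi n.+1) S t) \in I k).
pose g t := F (v t).
have bg : bounded_measurable g.
  apply: (@bounded_measurable_coord _ _ _ v L) => [k|w w' ww']; last first.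
    by apply: depF => k /andP[_ kL]; exact: ww'.
  rewrite /v; case: (n < k)%N => /=; first exact: measurable_iter_interval.
  rewrite (_ : [set t | _] = set0); first exact: measurable0.
  by apply/seteqP; split => x.
have gE y : F (hit y) = g (iter m S (iter (phi n) S y)).
  apply: depF => k /andP[nk _]; rewrite /v nk /= /hit -!iterD.
  have := phi_mono _ nk; have := phi_mono _ (ltnSn n).
  have : (phi n < phi n.+1)%N by apply: phi_increasing; lia.
  by move=> h1 h2 h3; do 3 f_equal; rewrite /m; lia.
have bf := bounded_measurable_interval_indic n.
have pm := measure_preserving_iter m S_preserving.
have bgm : bounded_measurable (fun t => g (iter m S t)).
  by apply: bounded_measurable_comp bg; case: pm.
have ig := bounded_measurable_integrable nu bg.
(* S^phi(n) is removed by invariance of [nu]; as [sg n] is the mean of the indicator, centering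
   produces exactly the covariance in the decay. *)
have -> : \int[nu]_y (centered sg (hit y) n * F (hit y)) =
    \int[nu]_t (interval_indic n t * g (iter m S t)) -
    (\int[nu]_t interval_indic n t) * (\int[nu]_t g t).
  transitivity (\int[nu]_t ((interval_indic n t - sg n) * g (iter m S t))).
    rewrite -[RHS](Rintegral_comp (measure_preserving_iter (phi n) S_preserving)).
      by apply: eq_Rintegral => y _; rewrite gE.
    apply/bounded_measurable_integrable/bounded_measurableM => //.
    by apply: bounded_measurableB => //; exact: bounded_measurable_cst.
  under eq_Rintegral do rewrite mulrBl.
  rewrite RintegralB_bounded; [|exact: bounded_measurableM|exact: bounded_measurableZ].
  rewrite RintegralZ_bounded// (Rintegral_comp pm)//; congr (_ - _ * _).
  rewrite -(expectation_hit n0).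
  by rewrite -[RHS](Rintegral_comp (measure_preserving_iter (phi n) S_preserving))//;
    exact: bounded_measurable_integrable.
have BV3 := BVnorm_interval (I n).
(* [g] has no regularity and enters only by its L^1 norm, at most 1; bounded variation is asked only
   of the indicator of one interval. *)
have Lg : g \in Lfun nu 1%E by apply/Lfun1_integrable.
have := decay m _ _ m0 (le_lt_trans BV3 (ltry 3)) Lg.
rewrite -lee_fin => /le_trans; apply.
have r0 := rho_ge0 m0.
have N1 : ('N[nu]_1%E[EFin \o g] <= 1%:E)%E.
  rewrite Lnorm1.
  apply: (@le_trans _ _ (\int[nu]_x (cst 1%:E x))%E).
    apply: ge0_le_integral => //.
    - by apply: measurableT_comp => //; apply/measurable_EFinP; case: bg.
    - by move=> x _; rewrite lee_fin F1.
  by rewrite integral_cst// mul1e; exact: probability_le1.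
apply: (@le_trans _ _ ((C' * rho m)%:E * 3%:E * 1%:E)%E).
  apply: lee_pmul => //.
  - apply: mule_ge0; first by rewrite lee_fin mulr_ge0// ltW.
    apply: adde_ge0.
      apply: le_trans (ereal_sup_ubound _); last by exists (unitI0 R).
      by rewrite lee_fin.
    by apply: total_variation_ge0; exact: ler01.
  - exact: Lnorm_ge0.
  - by rewrite lee_wpmul2l// lee_fin mulr_ge0// ltW.
rewrite mule1 -EFinM lee_fin.
rewrite (_ : C' * rho m * 3 = 3 * C' * rho m); last by ring.
rewrite -[leRHS]mulrA; apply: ler_wpM2l; last exact: rho_phi.
by rewrite mulr_ge0// ltW.
Qed.

End mixing.

(** * Second moments *)

Lemma hits_split (v : nat -> bool) a b : (a <= b)%N ->
  (hits v b - hits v a = \sum_(a.+1 <= i < b.+1) v i)%N.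
Proof.
by move=> ab; rewrite /hits (big_cat_nat (n := a.+1) (p := b.+1))//= addKn.
Qed.

Lemma hits_diff_dep (v v' : nat -> bool) a b : (a <= b)%N ->
  (forall i, (a < i <= b)%N -> v i = v' i) ->
  (hits v b - hits v a = hits v' b - hits v' a)%N.
Proof.
move=> ab vv'; rewrite !hits_split//; apply: eq_big_nat => i /andP[ai ib].
by rewrite vv'// ai -ltnS.
Qed.

(** [hits] remembers the whole past, but the shifts are differences, in which everything up to index
    k + 1 cancels. This is what makes [mixing] applicable to the grouped sums. *)
Lemma vdc_shift_dep (v v' : nat -> bool) m h k L : (k + h + m + 2 <= L)%N ->
  (forall i, (k.+1 < i < L)%N -> v i = v' i) ->
  vdc_shift (fun j => hits v j.+1) m h k = vdc_shift (fun j => hits v' j.+1) m h k.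
Proof.
move=> kL vv'; rewrite /vdc_shift.
by congr (_, _, _); apply: hits_diff_dep => [|i]; try lia; move=> ?; apply: vv'; lia.
Qed.

Section second_moments.
Context d (Y : measurableType d) (R : realType) (nu : probability Y R).
Variables (u : Y -> nat -> bool) (sg : nat -> R) (K : R).
Hypothesis sg_ge0 : forall k, 0 <= sg k.
Hypothesis sg_le1 : forall k, sg k <= 1.
Hypothesis mu_coord : forall k, measurable [set y | u y k].
Hypothesis expectation : forall n, (0 < n)%N -> \int[nu]_y (u y n)%:R = sg n.
Hypothesis mixing : forall n L (F : (nat -> bool) -> R), (0 < n)%N ->
  (forall v v', (forall k, (n < k < L)%N -> v k = v' k) -> F v = F v') ->
  (forall v, `|F v| <= 1) ->
  `|\int[nu]_y (centered sg (u y) n * F (u y))| <= K / n%:R.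

Local Notation z v k := (centered sg v k.+1).

Let z_le1 v k : `|z v k| <= 1. Proof. exact: centered_le1. Qed.

Let bnd (F : (nat -> bool) -> R) n :
  (forall v v', (forall k, (k < n)%N -> v k = v' k) -> F v = F v') ->
  bounded_measurable (fun y => F (u y)).
Proof. exact: bounded_measurable_coord. Qed.

Let bz k : bounded_measurable (fun y => z (u y) k).
Proof.
by apply: (@bnd (fun v => z v k) k.+2) => v v' vv'; rewrite /centered vv'.
Qed.

Lemma expectation_sqr_le k : \int[nu]_y (z (u y) k ^+ 2) <= 2 * sg k.+1.
Proof.
have bu : bounded_measurable (fun y => (u y k.+1)%:R : R).
  by apply: (@bnd (fun v => (v k.+1)%:R) k.+2) => v v' vv'; rewrite vv'.
have bc : bounded_measurable (fun y : Y => sg k.+1) by exact: bounded_measurable_cst.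
apply: (@le_trans _ _ (\int[nu]_y ((u y k.+1)%:R + sg k.+1))).
  apply: ler_Rintegral; first exact: bounded_measurableX.
    exact: bounded_measurableD.
  move=> y; rewrite /centered; have := sg_ge0 k.+1; have := sg_le1 k.+1.
  by case: (u y k.+1) => /=; nra.
rewrite RintegralD_bounded// expectation// Rintegral_prob_cst.
by rewrite mulr_natl mulr2n.
Qed.

(** The diagonal costs the weight and not the number of terms; the exponents in
    [vdc_term_expectation_le] rely on this gain. *)
Lemma sum_expectation_sqr_le N :
  \int[nu]_y (\sum_(0 <= k < N) z (u y) k ^+ 2) <= 2 * weight sg N.
Proof.
rewrite Rintegral_sum; last by move=> k _; exact: bounded_measurableX.
rewrite /weight big_add1/= mulr_sumr; apply: ler_sum => k _.
exact: expectation_sqr_le.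
Qed.

Lemma sum_pair_mixing_le N (P : nat -> nat -> Y -> R) :
  (forall k l, (k < l < N)%N -> bounded_measurable (P k l)) ->
  (forall k l, (k < l < N)%N -> `|\int[nu]_y P k l y| <= K / k.+1%:R) ->
  \int[nu]_y (\sum_(0 <= k < N) \sum_(k.+1 <= l < N) P k l y) <=
  N%:R * (K * \sum_(0 <= k < N) k.+1%:R^-1).
Proof.
move=> bP PK.
have K0 : 0 <= K.
  have := @mixing 1 0 (fun=> 0) isT (fun _ _ _ => erefl).
  rewrite normr0 divr1 => /(_ (fun=> ler01)).
  exact: le_trans (normr_ge0 _).
(* The bounds are given for k < l < N only; extension by 0 makes every term integrable. *)
pose P' k l := if (k < l < N)%N then P k l else fun=> 0.
have bP' k l : bounded_measurable (P' k l).
  rewrite /P'; case: ifP => // kl; [exact: bP|exact: bounded_measurable_cst].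
have E y : \sum_(0 <= k < N) \sum_(k.+1 <= l < N) P k l y =
    \sum_(0 <= k < N) \sum_(k.+1 <= l < N) P' k l y.
  by apply: eq_big_nat => k _; apply: eq_big_nat => l h; rewrite /P' h.
under eq_Rintegral do rewrite E.
rewrite Rintegral_sum; last by move=> k _; exact: bounded_measurable_sum.
rewrite mulrC -mulrA mulr_suml mulr_sumr; apply: ler_sum => k _.
rewrite Rintegral_sum//.
apply: (@le_trans _ _ (\sum_(k.+1 <= l < N) K / k.+1%:R)).
  rewrite big_nat_cond [leRHS]big_nat_cond; apply: ler_sum => l /andP[h _].
  rewrite /P' h; apply: le_trans (ler_norm _) _; exact: PK.
rewrite sumr_const_nat -[_ *+ _]mulr_natr -mulrA.
apply: ler_wpM2l => //; apply: ler_wpM2l; first by rewrite invr_ge0.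
by rewrite ler_nat leq_subr.
Qed.

Lemma hits_second_moment_le N :
  \int[nu]_y (((hits (u y) N)%:R - weight sg N) ^+ 2) <=
  N%:R + 2 * (N%:R * (K * \sum_(0 <= k < N) k.+1%:R^-1)).
Proof.
have E y : ((hits (u y) N)%:R - weight sg N) ^+ 2 =
    \sum_(0 <= k < N) z (u y) k ^+ 2 +
    2 * \sum_(0 <= k < N) \sum_(k.+1 <= l < N) z (u y) k * z (u y) l.
  by rewrite -sum_sqr sumrB -natr_sum /hits /weight !big_add1.
under eq_Rintegral do rewrite E.
have bzz k l : bounded_measurable (fun y => z (u y) k * z (u y) l).
  exact: bounded_measurableM.
have b1 : bounded_measurable (fun y => \sum_(0 <= k < N) z (u y) k ^+ 2).
  by apply: bounded_measurable_sum => k _; exact: bounded_measurableX.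
have b2 : bounded_measurable (fun y =>
    \sum_(0 <= k < N) \sum_(k.+1 <= l < N) z (u y) k * z (u y) l).
  by apply: bounded_measurable_sum => k _; exact: bounded_measurable_sum.
rewrite RintegralD_bounded//; last exact: bounded_measurableZ.
rewrite RintegralZ_bounded//; apply: lerD; last first.
  apply: ler_wpM2l => //; apply: sum_pair_mixing_le => [//|k l /andP[kl lN]].
  apply: (@mixing k.+1 l.+2 (fun v => z v l)) => // v v' vv'.
  by rewrite /centered vv'//; lia.
apply: le_trans (ler_norm _) _; apply: Rintegral_norm_le => // y.
rewrite ger0_norm; last by apply: sumr_ge0 => k _; exact: sqr_ge0.
apply: (@le_trans _ _ (\sum_(0 <= k < N) 1)).
  by apply: ler_sum => k _; exact: sqr_le1.
by rewrite sumr_const_nat subn0.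
Qed.

Lemma sum_indic_le1 (I : finType) (T : eqType) (emb : I -> T) (x : T) :
  injective emb -> \sum_(t : I) (x == emb t)%:R <= 1 :> R.
Proof.
move=> inj; have [t0 /eqP ->|no] := pickP (fun t => x == emb t).
  rewrite (bigD1 t0)//= eqxx big1 ?addr0// => t tt0.
  by rewrite (inj_eq inj) eq_sym (negbTE tt0).
by rewrite big1 ?ler01// => t _; rewrite no.
Qed.

Variables (N M1 M2 m h : nat).
Hypothesis m_gt0 : (0 < m)%N.
Hypothesis h_gt0 : (0 < h)%N.

Local Notation corr v t := (vdc_corr (fun k => z v k) (fun k => hits v k.+1) N
  (M1 := M1) (M2 := M2) m h t).

Let emb (t : 'I_M1 * 'I_M2 * 'I_M1) : nat * nat * nat :=
  (t.1.1 : nat, t.1.2 : nat, t.2 : nat).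

Let emb_inj : injective emb.
Proof.
by move=> [[a b] c] [[a' b'] c'] [/val_inj -> /val_inj -> /val_inj ->].
Qed.

Let q v k := vdc_coef2 (fun k => z v k) M1 M2 m h k.
Let sh v k := vdc_shift (fun k => hits v k.+1) m h k.
Let ind v k l : R := \sum_t (sh v k == emb t)%:R * (sh v l == emb t)%:R.
(** [q] without its factor of smallest index: since [m] and [h] are positive, all other centered
    factors come strictly later. *)
Let rest v k := (k %% M2 + h < M2)%N%:R * ((k %% M1 + m < M1)%N%:R *
  (z v (k + m) * vdc_coef1 (fun k => z v k) M1 m (k + h))).

Let qE v k : q v k = z v k * rest v k.
Proof. by rewrite /q /rest /vdc_coef2 {1}/vdc_coef1; ring. Qed.

Let b_le1 (b : bool) : `|b%:R : R| <= 1.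
Proof. by rewrite normr_nat lern1 leq_b1. Qed.

Let rest_le1 v k : `|rest v k| <= 1.
Proof. by do ?[apply: normrM_le1 => //]. Qed.

Let q_le1 v k : `|q v k| <= 1.
Proof. by rewrite qE; exact: normrM_le1. Qed.

Let ind_ge0 v k l : 0 <= ind v k l.
Proof. by apply: sumr_ge0 => t _; rewrite mulr_ge0. Qed.

Let ind_le1 v k l : ind v k l <= 1.
Proof.
apply: le_trans (sum_indic_le1 (sh v k) emb_inj); apply: ler_sum => t _.
by rewrite ler_piMr// lern1 leq_b1.
Qed.

(* The factor [z v k] has the smallest index in each off-diagonal term, hence
   the others only depend on later hits and [mixing] applies. *)
Let sum_corr_sqr v : \sum_t corr v t ^+ 2 =
  \sum_(0 <= k < N) ind v k k * q v k ^+ 2 +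
  2 * \sum_(0 <= k < N) \sum_(k.+1 <= l < N) z v k * (rest v k * q v l * ind v k l).
Proof.
under eq_bigr do rewrite /vdc_corr sum_sqr.
rewrite big_split/= -mulr_sumr; congr (_ + 2 * _).
- rewrite exchange_big/=; apply: eq_bigr => k _.
  by rewrite /ind mulr_suml; apply: eq_bigr => t _; rewrite exprMn -expr2.
- rewrite exchange_big/=; apply: eq_bigr => k _.
  rewrite exchange_big/=; apply: eq_bigr => l _.
  rewrite /ind !mulr_sumr; apply: eq_bigr => t _.
  by rewrite -!/(q _ _) -!/(sh _ _) -!/(emb _) [q v k]qE; ring.
Qed.

Let agree a L (v v' : nat -> bool) := forall i, (a < i < L)%N -> v i = v' i.

Let coef1_dep a L k v v' : agree a L v v' -> (a <= k)%N -> (k + m + 2 <= L)%N ->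
  vdc_coef1 (fun k => z v k) M1 m k = vdc_coef1 (fun k => z v' k) M1 m k.
Proof.
clear m_gt0 h_gt0; move=> vv' ak kL; rewrite /vdc_coef1 /centered.
by rewrite !(vv' k.+1, vv' (k + m).+1)//; lia.
Qed.

Let rest_dep a L k v v' : agree a L v v' -> (a <= k.+1)%N ->
  (k + h + m + 2 <= L)%N -> rest v k = rest v' k.
Proof.
move=> vv' ak kL; rewrite /rest (coef1_dep vv'); try lia.
by rewrite /centered (vv' (k + m).+1)//; lia.
Qed.

Let q_dep a L k v v' : agree a L v v' -> (a <= k)%N ->
  (k + h + m + 2 <= L)%N -> q v k = q v' k.
Proof.
clear m_gt0 h_gt0; move=> vv' ak kL; rewrite /q /vdc_coef2.
by rewrite !(coef1_dep vv')//; lia.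
Qed.

Let ind_dep a L k l v v' : agree a L v v' -> (a <= k.+1)%N -> (a <= l.+1)%N ->
  (k + h + m + 2 <= L)%N -> (l + h + m + 2 <= L)%N -> ind v k l = ind v' k l.
Proof.
move=> vv' ak al kL lL; rewrite /ind /sh.
rewrite (@vdc_shift_dep v v' m h k L)// => [|i ?]; last by apply: vv'; lia.
by rewrite (@vdc_shift_dep v v' m h l L)// => i ?; apply: vv'; lia.
Qed.

Lemma bounded_measurable_corr :
  bounded_measurable (fun y => \sum_t corr (u y) t ^+ 2).
Proof.
clear m_gt0 h_gt0; apply: (@bnd (fun v => \sum_t corr v t ^+ 2) (N + h + m + 2)) => v v' vv'.
have agr : agree 0 (N + h + m + 2) v v' by move=> i /andP[_ iL]; exact: vv'.
apply: eq_bigr => t _; congr (_ ^+ 2); apply: eq_big_nat => k /andP[_ kN].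
congr (_ * _); last by apply: (q_dep agr); lia.
by rewrite (@vdc_shift_dep v v' m h k (N + h + m + 2))// => [|i ?]; [lia|apply: vv'; lia].
Qed.

(** Each time has one triple, so [ind] is at most 1 and the number of triples does not enter: the
    bound is that of [hits_second_moment_le]. *)
Lemma corr_second_moment_le :
  \int[nu]_y (\sum_t corr (u y) t ^+ 2) <=
  N%:R + 2 * (N%:R * (K * \sum_(0 <= k < N) k.+1%:R^-1)).
Proof.
have agree0 L v v' : (forall k, (k < L)%N -> v k = v' k) -> agree 0 L v v'.
  by move=> vv' i /andP[_ iL]; exact: vv'.
have bd k : bounded_measurable (fun y => ind (u y) k k * q (u y) k ^+ 2).
  apply: (@bnd (fun v => ind v k k * q v k ^+ 2) (k + h + m + 2)) => v v' /agree0 vv'.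
  by rewrite (ind_dep vv')// (q_dep vv').
have bo k l : bounded_measurable
    (fun y => z (u y) k * (rest (u y) k * q (u y) l * ind (u y) k l)).
  apply: (@bnd (fun v => z v k * (rest v k * q v l * ind v k l)) (k + l + h + m + 2)).
  move=> v v' /agree0 vv'.
  rewrite (ind_dep vv') ?(q_dep vv') ?(rest_dep vv') /centered ?vv'//; lia.
under eq_Rintegral do rewrite sum_corr_sqr.
have b1 : bounded_measurable (fun y => \sum_(0 <= k < N) ind (u y) k k * q (u y) k ^+ 2).
  exact: bounded_measurable_sum.
have b2 : bounded_measurable (fun y => \sum_(0 <= k < N) \sum_(k.+1 <= l < N)
    z (u y) k * (rest (u y) k * q (u y) l * ind (u y) k l)).
  by apply: bounded_measurable_sum => k _; exact: bounded_measurable_sum.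
rewrite RintegralD_bounded//; last exact: bounded_measurableZ.
rewrite RintegralZ_bounded//; apply: lerD; last first.
  apply: ler_wpM2l => //; apply: sum_pair_mixing_le => [//|k l /andP[kl lN]].
  apply: (@mixing k.+1 (l + h + m + 2) (fun v => rest v k * q v l * ind v k l)) => //.
    move=> v v' vv'.
    by rewrite (ind_dep vv') ?(q_dep vv') ?(rest_dep vv')//; lia.
  move=> v; apply: normrM_le1; first exact: normrM_le1.
  by rewrite ger0_norm.
apply: le_trans (ler_norm _) _; apply: Rintegral_norm_le => // y.
rewrite ger0_norm; last by apply: sumr_ge0 => k _; rewrite mulr_ge0// sqr_ge0.
apply: (@le_trans _ _ (\sum_(0 <= k < N) 1)); last by rewrite sumr_const_nat subn0.
apply: ler_sum => k _; rewrite -[leRHS]mulr1.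
by apply: ler_pM => //; [exact: sqr_ge0|exact: sqr_le1].
Qed.

End second_moments.

(** * Almost every sequence is good *)

Section almost_every_sequence.
Context d (Y : measurableType d) (R : realType) (nu : probability Y R).
Variables (u : Y -> nat -> bool) (sg : nat -> R) (K : R) (c : nat).
Hypothesis sg_ge0 : forall k, 0 <= sg k.
Hypothesis sg_le1 : forall k, sg k <= 1.
Hypothesis mu_coord : forall k, measurable [set y | u y k].
Hypothesis expectation : forall n, (0 < n)%N -> \int[nu]_y (u y n)%:R = sg n.
Hypothesis K_ge0 : 0 <= K.
Hypothesis mixing : forall n L (F : (nat -> bool) -> R), (0 < n)%N ->
  (forall v v', (forall k, (n < k < L)%N -> v k = v' k) -> F v = F v') ->
  (forall v, `|F v| <= 1) ->
  `|\int[nu]_y (centered sg (u y) n * F (u y))| <= K / n%:R.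

Let p := (14 * c + 2)%N.

Hypothesis weight_large : forall j, (0 < j)%N ->
  (j ^ (13 * c + 4))%:R <= weight sg (j ^ p).

Local Notation W := (weight sg).

Let moment_bound (j : nat) : R :=
  (j ^ p)%:R + 2 * ((j ^ p)%:R * (K * (1 + p%:R * j%:R))).

Let moment_boundP (j : nat) : (0 < j)%N ->
  (j ^ p)%:R + 2 * ((j ^ p)%:R * (K * \sum_(0 <= k < j ^ p) k.+1%:R^-1)) <=
  moment_bound j.
Proof.
move=> j0; rewrite lerD2l ler_wpM2l// ler_wpM2l// ler_wpM2l//.
exact: harmonic_sum_le.
Qed.

Let Kp : R := 1 + 2 * K * (1 + p%:R).

Let Kp_ge1 : 1 <= Kp.
Proof. by rewrite lerDl !mulr_ge0// addr_ge0. Qed.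

Let moment_bound_le (j : nat) : (0 < j)%N ->
  moment_bound j <= (j%:R ^+ c) ^+ 14 * j%:R ^+ 3 * Kp.
Proof.
have E : j%:R ^+ p = (j%:R ^+ c) ^+ 14 * j%:R ^+ 2 :> R.
  by rewrite /p exprD mulnC exprM.
move=> j0; rewrite /moment_bound natrX E /Kp; move: (p%:R : R) (ler0n R p) => P P0.
set x : R := j%:R; set y := x ^+ c.
have x1 : 1 <= x by rewrite ler1n.
have y0 : 0 <= y by rewrite exprn_ge0.
rewrite [leLHS](_ : _ = y ^+ 14 * x ^+ 2 * (1 + 2 * K * (1 + P * x))); last by ring.
rewrite [leRHS](_ : _ = y ^+ 14 * x ^+ 2 * (x * (1 + 2 * K * (1 + P)))); last by ring.
apply: ler_wpM2l; first by rewrite mulr_ge0// exprn_ge0// (le_trans ler01).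
have : 0 <= (x - 1) * (1 + 2 * K) by rewrite mulr_ge0 ?subr_ge0// addr_ge0// mulr_ge0.
lra.
Qed.

Let bz k : bounded_measurable (fun y => centered sg (u y) k.+1).
Proof.
apply: (@bounded_measurable_coord _ _ _ u k.+2 (fun v => centered sg v k.+1)) => //.
by move=> v v' vv'; rewrite /centered vv'.
Qed.

Let bhits N : bounded_measurable (fun y => (hits (u y) N)%:R - W N).
Proof.
apply: bounded_measurableB; last exact: bounded_measurable_cst.
apply: (@bounded_measurable_coord _ _ _ u N.+1 (fun v => (hits v N)%:R)) => //.
move=> v v' vv'; congr (_%:R); apply: eq_big_nat => i /andP[_ iN].
by rewrite vv'.
Qed.

Let bvdc (j : nat) : bounded_measurable (fun y => vdc_term sg (u y) p c j).
Proof.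
apply: bounded_measurableZ; apply: bounded_measurableD.
  by apply: bounded_measurable_sum => k _; exact/bounded_measurableX/bz.
apply: bounded_measurable_sum => m _.
apply: bounded_measurableD; first exact: bounded_measurable_cst.
apply: bounded_measurableM; last exact: bounded_measurable_cst.
apply: bounded_measurableZ; apply: bounded_measurableD.
  exact: bounded_measurable_cst.
apply: bounded_measurable_sum => h _; apply: bounded_measurableD.
  exact: bounded_measurable_cst.
apply: bounded_measurableM; last exact: bounded_measurable_cst.
exact: bounded_measurable_corr.
Qed.

(** [vdc_bound] is linear in the squares, as [l1] and [l2] do not depend on y; integrating it
    amounts to replacing the squares by bounds on their expectations. *)
Let Rintegral_vdc_le N M1 B1 M2 B2 (l1 l2 D : R) : 0 < l1 -> 0 < l2 ->
  (forall m h, (0 < m)%N -> (0 < h)%N -> \int[nu]_y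
    (\sum_t vdc_corr (fun k => centered sg (u y) k.+1) (fun k => hits (u y) k.+1) N
      (M1 := M1) (M2 := M2) m h t ^+ 2) <= D) ->
  0 <= D ->
  \int[nu]_y vdc_bound (fun k => centered sg (u y) k.+1) (fun k => hits (u y) k.+1)
    N M1 B1 M2 B2 l1 l2 <=
  B1%:R * (2 * W N + M1%:R *
    (l1 + B2%:R * (N%:R + M2%:R * (l2 * (M1 * M2 * M1)%:R + D / l2)) / l1)).
Proof.
move=> l10 l20 HD D0.
pose X m h y := \sum_t vdc_corr (fun k => centered sg (u y) k.+1)
  (fun k => hits (u y) k.+1) N (M1 := M1) (M2 := M2) m h t ^+ 2.
have bX m h : bounded_measurable (X m h) by exact: bounded_measurable_corr.
have bc (r : R) : bounded_measurable (fun _ : Y => r) by exact: bounded_measurable_cst.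
have bXl m h : bounded_measurable (fun y => l2 * (M1 * M2 * M1)%:R + X m h y / l2).
  by apply: bounded_measurableD => //; exact: bounded_measurableM.
pose G m y := N%:R + \sum_(1 <= h < M2) (l2 * (M1 * M2 * M1)%:R + X m h y / l2).
have bG m : bounded_measurable (G m).
  by apply: bounded_measurableD => //; exact: bounded_measurable_sum.
have bGl m : bounded_measurable (fun y => l1 + B2%:R * G m y / l1).
  apply: bounded_measurableD => //; apply: bounded_measurableM => //.
  exact: bounded_measurableZ.
have bzz : bounded_measurable (fun y => \sum_(0 <= k < N) centered sg (u y) k.+1 ^+ 2).
  by apply: bounded_measurable_sum => k _; exact: bounded_measurableX.
have bsum : bounded_measurable (fun y => \sum_(1 <= m < M1) (l1 + B2%:R * G m y / l1)).
  exact: bounded_measurable_sum.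
rewrite (_ : \int[nu]_y _ = \int[nu]_y (B1%:R *
  (\sum_(0 <= k < N) centered sg (u y) k.+1 ^+ 2 +
   \sum_(1 <= m < M1) (l1 + B2%:R * G m y / l1))))//.
rewrite RintegralZ_bounded; last exact: bounded_measurableD.
apply: ler_wpM2l => //.
rewrite RintegralD_bounded//.
apply: lerD; first exact: sum_expectation_sqr_le.
have sum_le (M : nat) (f : nat -> R) (r : R) : 0 <= r ->
    (forall m, (0 < m < M)%N -> f m <= r) -> \sum_(1 <= m < M) f m <= M%:R * r.
  move=> r0 fr; apply: (@le_trans _ _ (\sum_(1 <= m < M) r)).
    rewrite big_nat_cond [leRHS]big_nat_cond.
    by apply: ler_sum => m /andP[hm _]; exact: fr.
  by rewrite sumr_const_nat -[_ *+ _]mulr_natl ler_wpM2r// ler_nat leq_subr.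
have in0 : 0 <= l2 * (M1 * M2 * M1)%:R + D / l2.
  by apply: addr_ge0; apply: mulr_ge0 => //; rewrite ?invr_ge0; exact: ltW.
rewrite Rintegral_sum//; apply: (sum_le) => [|m /andP[m0 _]].
  apply: addr_ge0; first exact: ltW.
  apply: mulr_ge0; last by rewrite invr_ge0 ltW.
  by apply: mulr_ge0 => //; apply: addr_ge0 => //; exact: mulr_ge0.
rewrite (_ : \int[nu]_y _ = \int[nu]_y (l1 + (B2%:R / l1) * G m y)); last first.
  by apply: eq_Rintegral => y _; rewrite /G mulrAC.
rewrite RintegralD_bounded//; last exact: bounded_measurableZ.
rewrite Rintegral_prob_cst RintegralZ_bounded// lerD2l mulrAC.
rewrite ler_pM2r ?invr_gt0//; apply: ler_wpM2l => //.
rewrite RintegralD_bounded//; last exact: bounded_measurable_sum.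
rewrite Rintegral_prob_cst lerD2l Rintegral_sum//.
apply: (sum_le) => // h /andP[h0 _].
rewrite RintegralD_bounded//; last exact: bounded_measurableM.
rewrite Rintegral_prob_cst lerD2l.
under eq_Rintegral do rewrite mulrC.
by rewrite RintegralZ_bounded// mulrC ler_pM2r ?invr_gt0//; exact: HD.
Qed.

(** Write y = j^c and x = j. Up to powers of x, the four terms found below are at most y^13 W or
    y^26, while W is at least y^13 x^4; the spare powers of x give j^-2. In the constant, 5 = 2 + 2
    + 1 pays for the first three terms and [Kp] for the second moment. *)
Lemma vdc_term_expectation_le j : (0 < j)%N ->
  \int[nu]_y (vdc_term sg (u y) p c j / W (j ^ p)%N ^+ 2) <= (5 + Kp) / j%:R ^+ 2.
Proof.
move=> j0; have jp k : 0 < (j ^ k)%:R :> R by rewrite ltr0n expn_gt0 j0.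
have D0 : 0 <= moment_bound j.
  by rewrite /moment_bound addr_ge0 ?mulr_ge0// addr_ge0 ?mulr_ge0.
have W0 : 0 < W (j ^ p) := lt_le_trans (jp _) (weight_large j0).
under eq_Rintegral do rewrite mulrC.
rewrite RintegralZ_bounded// mulrC ler_pdivrMr ?exprn_gt0//.
apply: le_trans (Rintegral_vdc_le _ _ (jp _) (jp _) _ D0) _.
  move=> m h m0 h0; apply: le_trans (moment_boundP j0).
  exact: corr_second_moment_le.
have := moment_bound_le j0; have := weight_large j0.
set V := W _ in W0 *; set D := moment_bound j.
set x : R := j%:R; set y := x ^+ c.
have pw (a b e : nat) : e = (c * a + b)%N -> (j ^ e)%:R = y ^+ a * x ^+ b :> R.
  by move=> ->; rewrite natrX exprD exprM.
rewrite (pw 13 2 (p - c)%N); last by rewrite /p; lia.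
rewrite (pw 10 2 (p - 4 * c)%N); last by rewrite /p; lia.
rewrite (pw 12 2 (p - 2 * c)%N); last by rewrite /p; lia.
rewrite (pw 14 2 p); last by rewrite /p; lia.
rewrite (pw 13 4 (13 * c + 4)%N); last by lia.
rewrite !natrM (pw 4 0 (4 * c)%N); last by lia.
rewrite (pw 1 0 c); last by lia.
rewrite expr0 !mulr1 expr1 => hV hD.
have x1 : 1 <= x by rewrite ler1n.
have x0 : 0 < x by exact: lt_le_trans x1.
have y1 : 1 <= y by exact: exprn_ege1.
have y0 : 0 < y by exact: lt_le_trans y1.
have x00 : x != 0 by rewrite gt_eqF.
have y00 : y != 0 by rewrite gt_eqF.
have -> : y ^+ 13 * x ^+ 2 * (2 * V + y * (y ^+ 12 * x ^+ 2 + y ^+ 10 * x ^+ 2 *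
    (y ^+ 14 * x ^+ 2 + y ^+ 4 * (y ^+ 4 * (y * y ^+ 4 * y) + D / y ^+ 4)) /
    (y ^+ 12 * x ^+ 2))) =
    2 * (y ^+ 13 * x ^+ 2 * V) + 2 * (y ^+ 26 * x ^+ 4) + y ^+ 26 * x ^+ 2 +
    y ^+ 12 * x ^+ 2 * D.
  by field; rewrite ?x00 ?y00.
set U := y ^+ 13 * x ^+ 4 in hV.
have U0 : 0 <= U by rewrite mulr_ge0 ?exprn_ge0 ?ltW.
have UV : U ^+ 2 <= V ^+ 2 by rewrite lerXn2r ?nnegrE// ltW.
have UV' : U * V <= V ^+ 2 by rewrite expr2 ler_wpM2r// ltW.
have x20 : 0 < x ^+ 2 by rewrite exprn_gt0.
rewrite [leRHS]mulrAC ler_pdivlMr//.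
have x2 : 1 <= x ^+ 2 by exact: exprn_ege1.
have e1 : y ^+ 13 * x ^+ 2 * V * x ^+ 2 = U * V by rewrite /U; ring.
have e2 : y ^+ 26 * x ^+ 4 * x ^+ 2 <= U ^+ 2.
  rewrite (_ : U ^+ 2 = y ^+ 26 * x ^+ 4 * x ^+ 2 * x ^+ 2); last by rewrite /U; ring.
  by rewrite ler_peMr// !mulr_ge0// ?exprn_ge0// ltW.
have e3 : y ^+ 26 * x ^+ 2 * x ^+ 2 <= U ^+ 2.
  rewrite (_ : U ^+ 2 = y ^+ 26 * x ^+ 2 * x ^+ 2 * x ^+ 4); last by rewrite /U; ring.
  by rewrite ler_peMr ?exprn_ege1// !mulr_ge0// ?exprn_ge0// ltW.
have e4 : y ^+ 12 * x ^+ 2 * D * x ^+ 2 <= U ^+ 2 * Kp.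
  apply: (@le_trans _ _ (y ^+ 12 * x ^+ 2 * (y ^+ 14 * x ^+ 3 * Kp) * x ^+ 2)).
    by rewrite ler_pM2r// ler_pM2l// mulr_gt0 ?exprn_gt0.
  rewrite (_ : U ^+ 2 * Kp = y ^+ 12 * x ^+ 2 * (y ^+ 14 * x ^+ 3 * Kp) * x ^+ 2 * x);
    last by rewrite /U; ring.
  have Kp0 : 0 <= Kp by apply: le_trans Kp_ge1.
  by rewrite ler_peMr// !mulr_ge0// ?exprn_ge0// ltW.
have e5 : U ^+ 2 * Kp <= V ^+ 2 * Kp by rewrite ler_wpM2r// (le_trans _ Kp_ge1).
move: e1 e2 e3 e4 e5 UV UV'; lra.
Qed.

Lemma hits_moment_expectation_le j : (0 < j)%N ->
  \int[nu]_y ((((hits (u y) (j ^ p))%:R - W (j ^ p)%N) / W (j ^ p)%N) ^+ 2) <=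
  Kp / j%:R ^+ 2.
Proof.
move=> j0; have jp k : 0 < (j ^ k)%:R :> R by rewrite ltr0n expn_gt0 j0.
have W0 : 0 < W (j ^ p) := lt_le_trans (jp _) (weight_large j0).
have E y : (((hits (u y) (j ^ p))%:R - W (j ^ p)%N) / W (j ^ p)%N) ^+ 2 =
    (W (j ^ p)%N ^+ 2)^-1 * ((hits (u y) (j ^ p))%:R - W (j ^ p)%N) ^+ 2.
  by rewrite exprMn exprVn mulrC.
under eq_Rintegral do rewrite E.
rewrite RintegralZ_bounded; last exact/bounded_measurableX/bhits.
rewrite mulrC ler_pdivrMr ?exprn_gt0//.
apply: (@le_trans _ _ (moment_bound j)).
  apply: le_trans (moment_boundP j0); exact: hits_second_moment_le.
apply: (le_trans (moment_bound_le j0)).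
have := weight_large j0; set V := W _ in W0 *.
rewrite (_ : 13 * c + 4 = c * 13 + 4)%N; last by lia.
rewrite natrX exprD exprM.
set x : R := j%:R; set y := x ^+ c => hV.
have x1 : 1 <= x by rewrite ler1n.
have y1 : 1 <= y by exact: exprn_ege1.
have x0 : 0 < x by exact: lt_le_trans x1.
have y0 : 0 < y by exact: lt_le_trans y1.
have Kp0 : 0 <= Kp by apply: le_trans Kp_ge1.
rewrite [leRHS]mulrAC ler_pdivlMr ?exprn_gt0//.
rewrite [leLHS](_ : _ = Kp * (y ^+ 14 * x ^+ 5)); last by ring.
apply: ler_wpM2l => //; apply: (@le_trans _ _ ((y ^+ 13 * x ^+ 4) ^+ 2)).
  rewrite (_ : (_ * _) ^+ 2 = y ^+ 14 * x ^+ 5 * (y ^+ 12 * x ^+ 3)); last by ring.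
  apply: ler_peMr; first by apply: mulr_ge0; apply: exprn_ge0; exact: ltW.
  by apply: mulr_ege1; exact: exprn_ege1.
rewrite lerXn2r ?nnegrE//; last exact: ltW.
by apply: mulr_ge0; apply: exprn_ge0; exact: ltW.
Qed.

Hypothesis sg1_gt0 : 0 < sg 1%N.
Hypothesis sgS : forall k, (0 < k)%N -> sg k.+1 <= sg k.

(** Both properties concern the hits of y only, so one null set serves all systems. Each follows
    from expectations bounded by a multiple of j^-2. *)
Lemma almost_every_good : \forall y \ae nu,
  (hits (u y) n)%:R / W n @[n --> \oo] --> (1 : R) /\
  exists C, forall J,
    \sum_(0 <= j < J) vdc_term sg (u y) p c j.+1 / W (j.+1 ^ p)%N ^+ 2 <= C.
Proof.
have p0 : (0 < p)%N by rewrite /p; lia.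
have Kp0 : 0 <= Kp by apply: le_trans Kp_ge1.
have sum_le (r : R) J : 0 <= r -> \sum_(0 <= j < J) r / j.+1%:R ^+ 2 <= r * 2.
  by move=> r0; rewrite -mulr_sumr ler_wpM2l// sum_inv_sqr_le.
apply: ae_and.
  pose F j y := (((hits (u y) (j.+1 ^ p))%:R - W (j.+1 ^ p)%N) / W (j.+1 ^ p)%N) ^+ 2.
  have bF j : bounded_measurable (F j).
    apply/bounded_measurableX/bounded_measurableM; first exact: bhits.
    exact: bounded_measurable_cst.
  have : \forall y \ae nu, exists C', forall J, \sum_(0 <= j < J) F j y <= C'.
    apply: (ae_bounded_series (C := Kp * 2)) => //; first by move=> j y; exact: sqr_ge0.
    move=> J; rewrite Rintegral_sum//; apply: le_trans (sum_le Kp J Kp0).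
    by apply: ler_sum => j _; exact: hits_moment_expectation_le.
  apply: filterS => y [C' hC'].
  apply: (hits_cvg1 sg_ge0 sg1_gt0 sgS p0); apply: sqr_cvg0.
  exact: ge0_bounded_series_cvg0 (fun j => sqr_ge0 _) hC'.
apply: (ae_bounded_series (C := (5 + Kp) * 2)).
- move=> j; apply: bounded_measurableM; first exact: bvdc.
  exact: bounded_measurable_cst.
- move=> j y; rewrite mulr_ge0 ?invr_ge0 ?sqr_ge0//.
  rewrite /vdc_term /vdc_bound; apply: mulr_ge0 => //; apply: addr_ge0.
    by apply: sumr_ge0 => k _; exact: sqr_ge0.
  apply: sumr_ge0 => m _; apply: addr_ge0 => //; apply: mulr_ge0; last by rewrite invr_ge0.
  apply: mulr_ge0 => //; apply: addr_ge0 => //; apply: sumr_ge0 => h _.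
  apply: addr_ge0; first by apply: mulr_ge0.
  apply: mulr_ge0; last by rewrite invr_ge0.
  by apply: sumr_ge0 => t _; exact: sqr_ge0.
- move=> J; rewrite Rintegral_sum; last first.
    move=> j _; apply: bounded_measurableM; first exact: bvdc.
    exact: bounded_measurable_cst.
  apply: le_trans (sum_le (5 + Kp) J _); last by rewrite addr_ge0.
  by apply: ler_sum => j _; exact: vdc_term_expectation_le.
Qed.

End almost_every_sequence.

(** * Power densities and enumeration of hits *)

(** Truncate f at an essential bound. *)
Lemma Lfun_infty_bounded d (X : measurableType d) (R : realType)
    (mu : probability X R) (f : X -> R) : f \in Lfun mu +oo%E ->
  exists2 g, bounded_measurable g & \forall x \ae mu, f x = g x.
Proof.
rewrite inE => /andP[/[!inE]/= mf]; rewrite /finite_norm unlock.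
have muT : (0 < mu [set: X])%E by rewrite (probability_setT mu) lte01.
rewrite ifT; last exact: muT.
move=> fin.
have [K fK] : exists K, \forall x \ae mu, `|f x| <= K.
  have : (ess_sup mu (abse \o (EFin \o f)) <= `|fine (ess_sup mu (abse \o (EFin \o f)))|%:E)%E.
    case: (ess_sup _ _) fin => [r||]//= _; first by rewrite lee_fin ler_norm.
    by rewrite leNye.
  move/ess_supP => h; eexists; apply: filterS h => x /=; rewrite lee_fin; exact.
exists (fun x => Num.min K (Num.max (- K) (f x))); last first.
  apply: filterS fK => x; rewrite ler_norml => /andP[h1 h2].
  by rewrite max_r// min_r.
split.
  by apply: measurable_minr => //; exact: measurable_maxr.
exists `|K| => x; rewrite ler_norml ge_min ler_norm/= le_min le_max lerN2 ler_norm/= andbT.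
by rewrite lerNl -normrN ler_norm.
Qed.

(** A true equality, not one almost everywhere: [cond_exp] chooses from the set of versions, and
    this set is the same for f and g. *)
Lemma eq_cond_exp d (X : measurableType d) (R : realType)
    (mu : probability X R) (G : set (set X)) (f g : X -> R) :
  G `<=` measurable -> measurable_fun [set: X] f -> measurable_fun [set: X] g ->
  (\forall x \ae mu, f x = g x) -> cond_exp mu G f = cond_exp mu G g.
Proof.
move=> Gm mf mg fg; rewrite /cond_exp; congr (get _).
have E A : G A -> \int[mu]_(x in A) f x = \int[mu]_(x in A) g x.
  move=> GA; rewrite /Rintegral; congr fine; apply: ae_eq_integral => //.
  - exact: Gm.
  - by apply: measurable_funTS; exact/measurable_EFinP.
  - by apply: measurable_funTS; exact/measurable_EFinP.
  - by apply: filterS fg => x -> _.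
by apply/seteqP; split => h [h1 h2 h3]; split => // A GA; rewrite h3// E.
Qed.

Section power_density.
Context (R : realType) (a : R).
Hypothesis a_gt0 : 0 < a.
Hypothesis a_lt : a < 1 / 14.

(** At 0 the value is 0, so monotonicity starts at 1. *)
Definition power_density (n : nat) : R := n%:R `^ (- a).

Local Notation sg := power_density.

Lemma power_density_ge0 n : 0 <= sg n.
Proof. exact: powR_ge0. Qed.

Let sgE n : sg n = (n%:R `^ a)^-1.
Proof. by rewrite /power_density powRN. Qed.

Let powa_le (x y : R) : 0 <= x -> x <= y -> x `^ a <= y `^ a.
Proof.
move=> x0 xy; apply: ge0_ler_powR => //; first exact: ltW.
by rewrite nnegrE (le_trans x0).
Qed.

Let powa_ge1 n : (0 < n)%N -> 1 <= n%:R `^ a.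
Proof.
move=> n0; have : (1 : R) <= n%:R by rewrite ler1n.
by move=> /(powa_le ler01); rewrite powR1.
Qed.

Lemma power_density_le1 n : sg n <= 1.
Proof.
case: n => [|n]; last by rewrite sgE invf_le1 ?powa_ge1// (lt_le_trans ltr01)// powa_ge1.
by rewrite /power_density powR0 ?ler01// oppr_eq0 gt_eqF.
Qed.

Lemma power_density1 : sg 1 = 1.
Proof. by rewrite /power_density powR1. Qed.

Lemma power_density1_gt0 : 0 < sg 1.
Proof. by rewrite power_density1. Qed.

Lemma power_densityS n : (0 < n)%N -> sg n.+1 <= sg n.
Proof.
move=> n0; rewrite !sgE lef_pV2 ?posrE ?(lt_le_trans ltr01 (powa_ge1 _))//.
by apply: powa_le => //; rewrite ler_nat.
Qed.

Lemma power_density_cvg0 : sg n @[n --> \oo] --> 0.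
Proof.
apply/cvgr0Pnorm_le => e e0.
exists (Num.truncn (e^-1 `^ a^-1)).+1 => // n /= nn.
have n0 : (0 < n)%N by lia.
have P0 : 0 < n%:R `^ a :> R by rewrite (lt_le_trans ltr01)// powa_ge1.
rewrite ger0_norm ?power_density_ge0// sgE -[leRHS]invrK lef_pV2 ?posrE ?invr_gt0//.
have -> : e^-1 = (e^-1 `^ a^-1) `^ a.
  by rewrite -powRrM mulVf ?gt_eqF// powRr1// invr_ge0 ltW.
apply: powa_le; first exact: powR_ge0.
by apply/ltW/(lt_le_trans (truncnS_gt _)); rewrite ler_nat.
Qed.

(** W n >= n^(1-a) >= n^a because 2a < 1, so the inverse is dominated by the density itself. *)
Lemma power_density_weight_infty : (weight sg n)^-1 @[n --> \oo] --> 0.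
Proof.
apply: squeeze_cvgr power_density_cvg0; last exact: cvg_cst.
exists 1%N => // n /= n1; rewrite invr_ge0 (weight_ge0 power_density_ge0)/=.
have P0 : 0 < n%:R `^ a :> R by rewrite (lt_le_trans ltr01)// powa_ge1.
have h := weight_lower power_density1_gt0 power_densityS n.
rewrite sgE lef_pV2 ?posrE//; last first.
  by apply: weight_gt0 => //; [exact: power_density_ge0|exact: power_density1_gt0].
apply: le_trans h; rewrite sgE ler_pdivlMr// -powRD; last first.
  by apply/implyP => _; rewrite pnatr_eq0; lia.
rewrite -[leRHS]powRr1//; apply: ler_powR; first by rewrite ler1n.
by move: a_lt; lra.
Qed.

(** With N = j^(14c+2) one has W N >= N / N^a and N = j^(13c+4) j^(c-2). It remains that (14c+2) a
    <= c - 2, which follows from c (1 - 14a) >= 3 >= 2 + 2a. *)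
Lemma power_density_weight_large (c j : nat) : (2 <= c)%N ->
  3 <= c%:R * (1 - 14 * a) -> (0 < j)%N ->
  (j ^ (13 * c + 4))%:R <= weight sg (j ^ (14 * c + 2)).
Proof.
move=> c2 ca j0; set N := (j ^ (14 * c + 2))%N.
have N0 : (0 < N)%N by rewrite expn_gt0 j0.
have P0 : 0 < N%:R `^ a :> R by rewrite (lt_le_trans ltr01)// powa_ge1.
apply: le_trans (weight_lower power_density1_gt0 power_densityS N).
rewrite sgE ler_pdivlMr//.
have NE : N%:R = (j ^ (13 * c + 4))%:R * (j ^ (c - 2))%:R :> R.
  by rewrite -natrM -expnD; congr (_ ^ _)%:R; lia.
rewrite [leRHS]NE ler_wpM2l// /N !natrX.
rewrite -!powR_mulrn// -powRrM; apply: ler_powR; first by rewrite ler1n.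
rewrite natrB// natrD natrM; move: a_lt; nra.
Qed.

End power_density.

Section enumeration.
Variable w : nat -> bool.
Hypothesis hits_unbounded : forall n, exists k, (n <= hits w k)%N.

Definition hit_enum (n : nat) : nat := ex_minn (hits_unbounded n).

Lemma hits_hit_enum n : hits w (hit_enum n) = n.
Proof.
rewrite /hit_enum; case: ex_minnP => k nk kmin; apply/eqP; rewrite eqn_leq nk andbT.
case: k nk kmin => [|k] nk kmin; first by rewrite /hits big_geq.
rewrite hitsS; have := kmin k; rewrite ltnn => h.
have : ~~ (n <= hits w k)%N by apply/negP => /h.
by case: (w _) => /=; lia.
Qed.

Lemma hit_enum_hits k : w k.+1 -> hit_enum (hits w k.+1) = k.+1.
Proof.
move=> wk; rewrite /hit_enum; case: ex_minnP => i ki imin; apply/eqP.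
rewrite eqn_leq imin//= ltnNge; apply/negP => ik.
by have := hits_homo w ik; rewrite hitsS wk in ki; lia.
Qed.

Lemma hit_enum_hit n : (0 < n)%N -> (0 < hit_enum n)%N /\ w (hit_enum n).
Proof.
move=> n0; rewrite /hit_enum; case: ex_minnP => -[|k] nk kmin.
  by move: nk; rewrite /hits big_geq//; lia.
split => //; apply/negP => /negP wk; have := kmin k.
by move: nk; rewrite hitsS (negbTE wk) addn0 => nk /(_ nk); rewrite ltnn.
Qed.

Lemma enumerates_hit_enum : enumerates [set n | (0 < n)%N /\ w n] hit_enum.
Proof.
split.
  move=> i j /andP[i0 ij]; rewrite ltnNge; apply/negP => /(hits_homo w).
  by rewrite !hits_hit_enum; lia.
apply/seteqP; split => [_ [n /= n0 <-]|[|k] [//= _ wk]]; first exact: hit_enum_hit.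
exists (hits w k.+1); last exact: hit_enum_hits.
by rewrite /= hitsS wk addn1.
Qed.

End enumeration.

Theorem theoremC (R : realType)
    (nu : probability (unitI R) R) (S : unitI R -> unitI R)
    (rho : nat -> R) (I : nat -> interval R) (a : R)
    (phi : nat -> nat) (C : R)
    (S_preserving : measure_preserving nu S)
    (rho_ge0 : forall m : nat, (0 < m)%N -> 0 <= rho m)
    (S_decay : decay_of_correlation nu S rho)
    (a_range : 0 < a < 1 / 14)
    (I_sub : forall n : nat, (0 < n)%N -> [set` I n] `<=` `[0, 1])
    (I_measure : forall n : nat, (0 < n)%N ->
      nu (@unitI_val R @^-1` [set` I n]) = (n%:R `^ (- a))%:E)
    (phi_increasing : increasing_seq1 phi)
    (C_gt0 : 0 < C)
    (rho_phi : forall n : nat, (0 < n)%N ->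
      rho (phi n.+1 - phi n)%N <= C / n%:R) :
  \forall y \ae nu, exists b : nat -> nat,
    enumerates (hitting_times S phi I y) b /\
    forall (d : measure_display) (X : measurableType d)
      (mu : probability X R) (T1 T2 : X -> X) (f1 f2 : X -> R),
      measure_preserving mu T1 -> measure_preserving mu T2 ->
      (forall x, T1 (T2 x) = T2 (T1 x)) ->
      f1 \in Lfun mu +oo%E -> f2 \in Lfun mu +oo%E ->
      \forall x \ae mu,
        N%:R^-1 * \sum_(1 <= n < N.+1)
            f1 (iter n T1 x) * f2 (iter (b n) T2 x) @[N --> \oo] -->
        cond_exp mu (invariant_sets mu T1) f1 x *
        cond_exp mu (invariant_sets mu T2) f2 x.
Proof.
have /andP[a0 a1] := a_range.
have [C' C'0 decay] := S_decay.
pose sg : nat -> R := power_density a.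
have sg0 : forall n, 0 <= sg n by exact: power_density_ge0.
have sg1 : forall n, sg n <= 1 by exact: power_density_le1.
have sg_gt0 : 0 < sg 1 by exact: power_density1_gt0.
have sgS : forall n, (0 < n)%N -> sg n.+1 <= sg n by exact: power_densityS.
have sg_cvg : sg n @[n --> \oo] --> 0 by exact: power_density_cvg0.
have Winf : (weight sg n)^-1 @[n --> \oo] --> 0 by exact: power_density_weight_infty.
have b0 : 0 < 1 - 14 * a by lra.
(* Large enough for [ca], and at least 2 so that c - 2 is a true difference. *)
pose c := (Num.truncn (3 / (1 - 14 * a))).+2.
have ca : 3 <= c%:R * (1 - 14 * a).
  rewrite -ler_pdivrMr//; apply/ltW/(lt_le_trans (truncnS_gt _)).
  by rewrite ler_nat.
pose w (y : unitI R) := hit S I phi y.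
have K0 : 0 <= 3 * C' * C by rewrite !mulr_ge0// ltW.
have mcoord k : measurable [set y | w y k].
  exact: (measurable_iter_interval S_preserving).
have mean_hit n : (0 < n)%N -> \int[nu]_y (w y n)%:R = sg n.
  by move=> n0; exact: expectation_hit.
have mix n L (F : (nat -> bool) -> R) : (0 < n)%N ->
    (forall v v', (forall k, (n < k < L)%N -> v k = v' k) -> F v = F v') ->
    (forall v, `|F v| <= 1) ->
    `|\int[nu]_y (centered sg (w y) n * F (w y))| <= 3 * C' * C / n%:R.
  by move=> n0 depF F1; exact: mixing_hit decay depF F1.
have large j : (0 < j)%N ->
    (j ^ (13 * c + 4))%:R <= weight sg (j ^ (14 * c + 2))%N.
  exact: power_density_weight_large.
have good := almost_every_good sg0 sg1 mcoord mean_hit K0 mix large sg_gt0 sgS.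
apply: filterS good => y [hits1 [Cs vdc_sum]].
(* If the hits were bounded, their quotient by W would tend to 0 instead of 1. *)
have unb n : exists k, (n <= hits (w y) k)%N.
  apply: contrapT => nk.
  have lt k : (hits (w y) k <= n)%N.
    by rewrite leqNgt; apply/negP => /ltnW h; apply: nk; exists k.
  have lim0 : (hits (w y) k)%:R / weight sg k @[k --> \oo] --> (0 : R).
    apply: (squeeze_cvgr (f := fun=> 0) (h := fun k => n%:R * (weight sg k)^-1)).
    - apply: nearW => k; rewrite divr_ge0 ?(weight_ge0 sg0)//=.
      by rewrite ler_wpM2r ?invr_ge0 ?(weight_ge0 sg0)// ler_nat.
    - exact: cvg_cst.
    - by apply: (cvgZ_eq Winf) => //; rewrite mulr0.
  have /eqP : (0 : R) = 1.
    by rewrite -(cvg_lim (@Rhausdorff R) lim0) (cvg_lim (@Rhausdorff R) hits1).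
  by rewrite eq_sym oner_eq0.
exists (hit_enum unb); split; first exact: enumerates_hit_enum.
move=> d X mu T1 T2 f1 f2 pT1 pT2 TC Lf1 Lf2.
have [g1 bg1 fg1] := Lfun_infty_bounded Lf1.
have [g2 bg2 fg2] := Lfun_infty_bounded Lf2.
have mL (f : X -> R) : f \in Lfun mu +oo%E -> measurable_fun [set: X] f.
  by rewrite inE => /andP[/[!inE]].
have -> : cond_exp mu (invariant_sets mu T1) f1 = cond_exp mu (invariant_sets mu T1) g1.
  apply: eq_cond_exp fg1; [by move=> A []|exact: mL|by case: bg1].
have -> : cond_exp mu (invariant_sets mu T2) f2 = cond_exp mu (invariant_sets mu T2) g2.
  apply: eq_cond_exp fg2; [by move=> A []|exact: mL|by case: bg2].
have lim := hitting_avg_cvg_bounded sg0 sg1 sg_gt0 sgS sg_cvg Winf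
  (p := (14 * c + 2)%N) ltac:(lia) (c := c) ltac:(lia) hits1 vdc_sum pT1 pT2 TC
  (hits_hit_enum unb) (fun k wk => hit_enum_hits unb wk) bg1 bg2.
(* The representatives agree with [f1] and [f2] along whole orbits of almost every x, hence also at
   the times b n. *)
have := ae_and (ae_iter pT1 fg1) (ae_and (ae_iter pT2 fg2) lim).
apply: filterS => x [h1 [h2 {}lim]]; apply: cvg_trans lim; apply: near_eq_cvg.
apply: nearW => N /=; congr (_ * _); apply: eq_bigr => n _.
by rewrite h1 h2.
Qed.
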